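(* There are universal constants $c,C,C'>0$ such that the following holds. Let $m\in\mathbb{N}$, let $T$ be a finite nonempty set of $m$-tuples $t=(t_1,\ldots,t_m)$, and for each $t\in T$ let $X_t=(X_{t_1},\ldots,X_{t_m})$ be a tuple of real-valued subexponential random variables with $X_{t_i}$ defined on a probability space $(\Omega_i,\mathbb{P}_i)$, all considered on the product space $\prod_{i=1}^m(\Omega_i,\mathbb{P}_i)$. Set $$E_t=\frac1m\sum_{i=1}^m\big(X_{t_i}-\mathbb{E}X_{t_i}\big)\qquad(t\in T),$$ and let $\sigma,K>0$ be constants such that $$\sup_{t\in T}\frac1m\sum_{i=1}^m\mathbb{E}|X_{t_i}-\mathbb{E}X_{t_i}|^q\leq\frac{q!}{2}\sigma^2K^{q-2}\qquad(q=2,3,\ldots).$$ Then, for any $1\leq p<\infty$, $$\Big(\mathbb{E}\sup_{t\in T}|E_t|^p\Big)^{1/p}\leq C'\Big(\frac{1}{\sqrt m}\gamma_2(T,d_2)+\frac1m\gamma_1(T,d_1)+\sqrt p\,\frac{\sigma}{\sqrt m}+p\,\frac Km\Big).$$ In particular, for any $u\geq 1$, $$\mathbb{P}\Big(\sup_{t\in T}|E_t|\geq C\Big(\frac{1}{\sqrt m}\gamma_2(T,d_2)+\frac1m\gamma_1(T,d_1)\Big)+c\Big(\frac{\sigma}{\sqrt m}\sqrt u+\frac Km u\Big)\Big)\leq e^{-u}.$$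
   Context: For a random variable $X$, $\|X\|_{\psi_1}=\inf\{a>0:\mathbb{E}\exp(|X|/a)-1\leq 1\}$; $X$ is subexponential if $\|X\|_{\psi_1}<\infty$. The semi-metrics on $T$ are $$d_1(s,t)=\max_{1\leq i\leq m}\|X_{t_i}-X_{s_i}\|_{\psi_1},\qquad d_2(s,t)=\Big(\frac1m\sum_{i=1}^m\|X_{t_i}-X_{s_i}\|_{\psi_1}^2\Big)^{1/2}.$$ A sequence $\mathcal{T}=(T_n)_{n\geq 0}$ of nonempty subsets of $T$ is admissible if $|T_0|=1$ and $|T_n|\leq 2^{2^n}$ for all $n\geq 1$. For $0<\alpha<\infty$, $\gamma_\alpha(T,d)=\inf_{\mathcal{T}}\sup_{t\in T}\sum_{n=0}^\infty 2^{n/\alpha}d(t,T_n)$, where $d(t,T_n)=\inf_{s\in T_n}d(t,s)$ and the infimum is over all admissible sequences. *)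

(* Defs.v *)
From HB Require Import structures.
From mathcomp Require Import all_boot all_order all_algebra.
From mathcomp Require Import all_classical all_reals all_analysis.

Set Implicit Arguments.
Unset Strict Implicit.
Unset Printing Implicit Defensive.

Import Order.TTheory GRing.Theory Num.Theory.
Import numFieldNormedType.Exports.

Local Open Scope classical_set_scope.
Local Open Scope ring_scope.
Local Open Scope ereal_scope.

Definition psi1_norm (R : realType) (d : measure_display)
    (Omega : measurableType d) (P : probability Omega R) (X : Omega -> R)
    : \bar R :=
  ereal_inf [set a%:E | a in
    [set a : R | (0 < a)%R /\
                 'E_P[fun w => expR (`|X w| / a)%R] - 1 <= 1]].

Definition subexponential (R : realType) (d : measure_display)
    (Omega : measurableType d) (P : probability Omega R) (X : Omega -> R)
    : Prop :=
  psi1_norm P X < +oo.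

Definition point_dist (R : realType) (U : Type) (dist : U -> U -> \bar R)
    (t : U) (A : set U) : \bar R :=
  ereal_inf [set dist t s | s in A].

Definition admissible (U : Type) (T : set U) (Tn : nat -> set U) : Prop :=
  [/\ forall n, Tn n `<=` T /\ Tn n !=set0,
      (Tn 0%N #= `I_1)%card &
      forall n, (1 <= n)%N -> (Tn n #<= `I_(2 ^ (2 ^ n)))%card].

Definition gamma (R : realType) (alpha : R) (U : Type) (T : set U)
    (dist : U -> U -> \bar R) : \bar R :=
  ereal_inf [set
    ereal_sup [set \sum_(0 <= n <oo)
                     (2 `^ (n%:R / alpha))%:E * point_dist dist t (Tn n)
              | t in T]
  | Tn in admissible T].

(* The sigma-algebra of the product space is the one generated by the
   coordinate maps. *)
Definition cylinders (m : nat) (d : 'I_m -> measure_display)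
    (Omega : forall i, measurableType (d i)) : set (set (forall i, Omega i)) :=
  [set A | exists i (B : set (Omega i)),
     measurable B /\ A = [set w | B (w i)]].
Arguments cylinders {m d} Omega.

Definition prod_space (m : nat) (d : 'I_m -> measure_display)
    (Omega : forall i, measurableType (d i)) :=
  g_sigma_algebraType (cylinders Omega).
Arguments prod_space {m d} Omega.

(* By the pi-lambda theorem the product rule on measurable boxes determines
   the product measure uniquely. *)
Definition is_product_measure (R : realType) (m : nat)
    (d : 'I_m -> measure_display) (Omega : forall i, measurableType (d i))
    (P : forall i, probability (Omega i) R)
    (PP : probability (prod_space Omega) R) : Prop :=
  forall A : (forall i, set (Omega i)), (forall i, measurable (A i)) ->
    PP [set w | forall i, A i (w i)] = \prod_(i < m) P i (A i).

Definition cons_dep (m : nat) (F : 'I_m.+1 -> Type) (x : F ord0)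
    (f : forall j, F (lift ord0 j)) (i : 'I_m.+1) : F i :=
  match unliftP ord0 i with
  | UnliftSome j e => ecast k (F k) (esym e) (f j)
  | UnliftNone e => ecast k (F k) (esym e) x
  end.

Lemma cons_dep0 (m : nat) (F : 'I_m.+1 -> Type) (x : F ord0)
    (f : forall j, F (lift ord0 j)) : cons_dep x f ord0 = x.
Proof.
rewrite /cons_dep; case: unliftP => [j e|e].
  by exfalso; move/eqP: e; rewrite (negbTE (neq_lift _ _)).
by rewrite (eq_irrelevance e erefl).
Qed.

Lemma cons_depS (m : nat) (F : 'I_m.+1 -> Type) (x : F ord0)
    (f : forall j, F (lift ord0 j)) (j : 'I_m) :
  cons_dep x f (lift ord0 j) = f j.
Proof.
rewrite /cons_dep; case: unliftP => [k e|e].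
  have jk := lift_inj e; move: e; rewrite -jk => e.
  by rewrite (eq_irrelevance e erefl).
by exfalso; move/eqP: e; rewrite eq_sym (negbTE (neq_lift _ _)).
Qed.

(* [is_product_measure] is always satisfiable. *)
Lemma product_measure_exists (R : realType) (m : nat)
    (d : 'I_m -> measure_display) (Omega : forall i, measurableType (d i))
    (P : forall i, probability (Omega i) R) :
  exists PP : probability (prod_space Omega) R, is_product_measure P PP.
Proof.
elim: m d Omega P => [|m IH] d Omega P.
  exists (\d_(point : prod_space Omega)) => A mA.
  have -> : [set w : prod_space Omega | forall i, A i (w i)] = setT.
    by apply/seteqP; split=> // w _ [].
  by rewrite big_ord0; exact: probability_setT.
have [Q QE] := IH _ _ (fun j => P (lift ord0 j)).
pose Omega' := fun j => Omega (lift ord0 j).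
pose g (xf : Omega ord0 * prod_space Omega') : prod_space Omega :=
  cons_dep (F := fun i => Omega i) xf.1 xf.2.
have mg : measurable_fun setT g.
  refine (@measurability _ _ _ _ setT g (cylinders Omega) erefl _).
  move=> _ [_ [i [B [mB ->]] <-]]; rewrite setTI.
  case: (unliftP ord0 i) => [j|] e; subst i.
  - rewrite (_ : _ @^-1` _ = setT `*` [set w : prod_space Omega' | B (w j)]).
      apply: measurableX => //; apply: sub_sigma_algebra.
      by exists j, B.
    by apply: eq_set => -[x f]; rewrite /= /g /= cons_depS; apply: propext;
      split=> // -[].
  - rewrite (_ : _ @^-1` _ = B `*` setT).
      exact: measurableX.
    by apply: eq_set => -[x f]; rewrite /= /g /= cons_dep0; apply: propext;
      split=> // -[].
pose PQ : probability _ R := (P ord0 \x Q)%E.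
pose gm : {mfun _ >-> _} := mfun_Sub (mem_set mg).
exists (distribution PQ gm) => A mA.
have mA' : measurable [set f : prod_space Omega' |
    forall j, A (lift ord0 j) (f j)].
  rewrite (_ : [set f | _] =
      \bigcap_(j in [set: 'I_m]) [set f : prod_space Omega' |
         A (lift ord0 j) (f j)]); last first.
    by apply: eq_set => f; apply: propext; split=> [h j _|h j]; exact: h.
  apply: fin_bigcap_measurable => [|j _]; first exact: finite_finset.
  by apply: sub_sigma_algebra; exists j, (A (lift ord0 j)).
rewrite big_ord_recl -(QE (fun j => A (lift ord0 j)))//.
rewrite -product_measure1E//; congr (PQ _).
apply/seteqP; split => -[x f] /=.
- by move=> h; split=> [|j]; [have := h ord0; rewrite /g/= cons_dep0
    |have := h (lift ord0 j); rewrite /g/= cons_depS].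
- move=> [Ax Af] i; case: (unliftP ord0 i) => [j|] ->.
    by rewrite /g /= cons_depS; exact: Af.
  by rewrite /g /= cons_dep0.
Qed.

Section process.
Variables (R : realType) (m : nat) (d : 'I_m -> measure_display).
Variables (Omega : forall i, measurableType (d i)).
Variables (P : forall i, probability (Omega i) R).
(* [X i a] is the random variable on the i-th space attached to the index [a],
   so the X_{t_i} of the text is [X i (tnth t i)]. *)
Variables (S : Type) (X : forall i, S -> {RV (P i) >-> R}).

Definition increment_psi1 (i : 'I_m) (s t : m.-tuple S) : \bar R :=
  psi1_norm (P i) (X i (tnth t i) \- X i (tnth s i))%R.

(* The index -oo is never reached when m > 0. *)
Definition d1 (s t : m.-tuple S) : \bar R :=
  \big[maxe/-oo]_(i < m) increment_psi1 i s t.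

Definition d2 (s t : m.-tuple S) : \bar R :=
  sqrte ((m%:R^-1)%:E * \sum_(i < m) increment_psi1 i s t ^+ 2).

(* [fine] is harmless: a subexponential variable has a finite mean. *)
Definition centered (i : 'I_m) (a : S) (w : Omega i) : R :=
  (X i a w - fine 'E_(P i)[X i a])%R.

Definition emp (t : m.-tuple S) (w : prod_space Omega) : R :=
  (m%:R^-1 * \sum_(i < m) centered (tnth t i) (w i))%R.

Definition sup_emp (T : set (m.-tuple S)) (w : prod_space Omega) : R :=
  sup [set `|emp t w|%R | t in T].

End process.

(* Main.v *)
Require Import Defs.
From mathcomp Require Import all_boot all_order all_algebra.
From mathcomp Require Import all_classical all_reals all_analysis.
From mathcomp Require Import measurable_realfun ring lra.

Set Implicit Arguments.
Unset Strict Implicit.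
Unset Printing Implicit Defensive.

Import Order.TTheory GRing.Theory Num.Theory.
Import numFieldNormedType.Exports.
Import HBNNSimple.

Local Open Scope classical_set_scope.
Local Open Scope ring_scope.

(** Generic chaining truncated at the level [l] with [2 ^ l <= p < 2 ^ l.+1].
    With [exp_rem x = exp x - 1 - x], a centred variable satisfies
    [E exp(W - E W) <= exp(E (exp_rem |W|))], and [exp_rem (r x)] is at most
    [r ^ 2 * exp_rem x] for [0 <= r <= 1].  By independence this gives
    Bernstein-type bounds on the exponential moments of each [E_t] (from the
    moment condition) and of each increment [E_t - E_s] (from the psi_1
    norms).

    The two admissible sequences, for [d_1] and [d_2], are merged into maps
    [pi_n : T -> T] with at most [2 ^ (4 * 2 ^ n)] values.  Every variable met
    along a chain, either [E_t] with [t] in the range of [pi_l] or an increment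
    between levels [n] and [n + 1] with [n >= l], is divided by a scale
    [20 * delta], where the sum of the [delta] along a chain is the bound to be
    proved.  Since [y ^ p <= exp (q (y - 1))] for [y >= 1] and [q >= p], the
    p-th powers of all these ratios are dominated by [1] plus the sum of their
    exponentials, whose expectation is bounded by [2] by a union bound.  The
    tail estimate is Markov's inequality applied with [p = u]. *)

(** * The remainder of the exponential *)

Section exponential.
Variable R : realType.
Implicit Types x y r : R.

Definition exp_rem x : R := expR x - 1 - x.

Lemma exp_rem_ge0 x : 0 <= exp_rem x.
Proof. by have := expR_ge1Dx x; rewrite /exp_rem; lra. Qed.

Lemma measurable_exp_rem : measurable_fun setT exp_rem.
Proof.
by apply: measurable_funB => //; apply: measurable_funB.
Qed.

(** The series of [expR] without its terms of order 0 and 1. It is stated in the extended reals so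
    that it can be integrated term by term. *)
Lemma exp_rem_series x : 0 <= x ->
  (exp_rem x)%:E = (\sum_(2 <= q <oo) (x ^+ q / q`!%:R)%:E)%E.
Proof.
move=> x0.
have c0 q : (0 <= (exp_coeff x q)%:E)%E by rewrite lee_fin exp_coeff_ge0.
have -> : (\sum_(2 <= q <oo) (x ^+ q / q`!%:R)%:E =
    \sum_(2 <= q <oo) (exp_coeff x q)%:E)%E.
  by apply: eq_eseriesr => q _; rewrite exp_coeffE mulrC.
have : (expR x)%:E = (\sum_(0 <= q <oo) (exp_coeff x q)%:E)%E.
  rewrite -EFin_lim; last exact: is_cvg_series_exp_coeff.
  by apply: congr_lim; apply/funext => n /=; rewrite sumEFin.
rewrite (nneseries_split 0 2)// => /esym.
rewrite big_mkord big_ord_recr big_ord1/= !exp_coeffE/= expr0 expr1.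
rewrite invr1 !mul1r -EFinD => E.
(* An infinite tail would contradict [E], so only a real tail [s] remains. *)
move: E; case: (\big[_/_]_(2 <= q <oo) _)%E => //= s; rewrite -EFinD.
by case=> E; congr EFin; rewrite /exp_rem -E; ring.
Qed.

Lemma integral_nneseries_from d (T : measurableType d)
    (mu : {measure set T -> \bar R}) (N : nat) (f : nat -> T -> \bar R) :
  (forall n, measurable_fun setT (f n)) -> (forall n t, 0 <= f n t)%E ->
  (\int[mu]_t (\sum_(N <= n <oo) f n t) = \sum_(N <= n <oo) \int[mu]_t f n t)%E.
Proof.
move=> mf f0.
under eq_integral do rewrite eseries_cond eseries_mkcond.
rewrite eseries_cond eseries_mkcond/= integral_nneseries//.
- by apply: eq_eseriesr => n _; case: ifPn => // _; rewrite integral0.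
- by move=> n; case: (N <= n)%N.
- by move=> n t _; case: (N <= n)%N.
Qed.

(** From [q = 2] on, the factors [2 * 2^-1 ^+ q] have total 1. This sums the Bernstein moments when
    their ratio is at most 1/2. *)
Lemma nneseries_geometric_le (c : R) : 0 <= c ->
  (\sum_(2 <= q <oo) (c * (2 * 2^-1 ^+ q))%:E <= c%:E)%E.
Proof.
move=> c0; apply: lime_le.
  by apply: is_cvg_nneseries => n _ _; rewrite lee_fin mulr_ge0// mulr_ge0.
apply: nearW => -[|[|n]]; [by rewrite big_geq|by rewrite big_geq|].
rewrite sumEFin lee_fin -mulr_sumr ler_piMr//.
suff -> : \sum_(2 <= q < n.+2) (2 * 2^-1 ^+ q) = 1 - 2^-1 ^+ n :> R.
  by rewrite lerBlDr lerDl.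
elim: n => [|n IH]; first by rewrite big_geq// expr0 subrr.
by rewrite big_nat_recr//= IH !exprS; field.
Qed.

(** The series starts at [q = 2], and [r ^+ q <= r ^+ 2] from there on. *)
Lemma exp_rem_scale r x : 0 <= r <= 1 -> 0 <= x ->
  exp_rem (r * x) <= r ^+ 2 * exp_rem x.
Proof.
move=> /andP[r0 r1] x0; rewrite -lee_fin EFinM !exp_rem_series ?mulr_ge0//.
rewrite -nneseriesZl; last first.
  by move=> q _; rewrite lee_fin divr_ge0// exprn_ge0.
rewrite eseries_cond [leRHS]eseries_cond/=.
apply: lee_nneseries => [q _ _|q q2].
  by rewrite lee_fin divr_ge0// exprn_ge0// mulr_ge0.
rewrite -EFinM lee_fin exprMn mulrA ler_wpM2r// ler_wpM2r ?exprn_ge0//.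
exact: ler_wiXn2l.
Qed.

(** For [x = - y < 0] this is [expR y - expR (- y) >= 2 * y]: the difference of the two sides
    vanishes at 0 and has derivative [expR z + expR (- z) - 2 >= 0]. *)
Lemma exp_rem_norm x : exp_rem x <= exp_rem `|x|.
Proof.
have [x0|x0] := leP 0 x; first by rewrite ger0_norm.
rewrite ltr0_norm//.
suff : forall y, 0 <= y -> expR y - expR (- y) >= 2 * y.
  by move=> /(_ (- x)); rewrite opprK /exp_rem; lra.
move=> y y0.
pose f z : R := expR z - expR (- z) - 2 * z.
have df (z : R) : is_derive z (1 : R) f (expR z + expR (- z) - 2).
  rewrite /f; apply: is_derive_eq.
  by rewrite /GRing.scale/=; ring.
rewrite -subr_ge0.
have f0 : f 0 = 0 by rewrite /f oppr0 !expR0; ring.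
rewrite -[leLHS]f0.
apply: (@ger0_derive1_ndecr R f 0 y) => //.
- by move=> z _; rewrite derive1E derive_val; have := expR_ge1Dx z;
    have := expR_ge1Dx (- z); lra.
- by apply: derivable_within_continuous => z _.
Qed.

Lemma expR_convex r x y : 0 <= r <= 1 ->
  expR (r * x + (1 - r) * y) <= r * expR x + (1 - r) * expR y.
Proof.
move=> /andP[r0 r1]; set z := _ + _.
(* The tangent at the convex combination [z] lies below [expR]; averaging it over [x] and [y]
   cancels the linear terms. *)
have t u : expR z * (1 + (u - z)) <= expR u.
  have -> : expR u = expR z * expR (u - z) by rewrite -expRD subrKC.
  by rewrite ler_pM2l ?expR_gt0// expR_ge1Dx.
have := ler_wpM2l r0 (t x); have := @ler_wpM2l _ (1 - r) _ _ _ (t y).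
rewrite subr_ge0 => /(_ r1).
suff : r * (expR z * (1 + (x - z))) + (1 - r) * (expR z * (1 + (y - z))) =
    expR z by lra.
by rewrite /z; ring.
Qed.

End exponential.

(** * Independence of the coordinates *)

Section product.
Variable R : realType.

(* The hypothesis says that, under the measure of density [g], the law of [phi]
   is [c * nu]. *)
Lemma ge0_integral_factor d1 d2 (T1 : measurableType d1)
    (T2 : measurableType d2) (mu : {measure set T1 -> \bar R})
    (nu : {measure set T2 -> \bar R}) (phi : T1 -> T2) (g : T1 -> R) (c : R) :
  measurable_fun setT phi -> measurable_fun setT g -> (forall w, 0 <= g w) ->
  0 <= c ->
  (forall B, measurable B ->
    \int[mu]_w (g w * \1_B (phi w))%:E = c%:E * nu B)%E ->
  forall f : T2 -> R, measurable_fun setT f -> (forall x, 0 <= f x) ->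
  (\int[mu]_w (g w * f (phi w))%:E = c%:E * \int[nu]_x (f x)%:E)%E.
Proof.
move=> mphi mg g0 c0 gB f mf f0.
have mEf : measurable_fun setT (EFin \o f) by exact/measurable_EFinP.
pose h := nnsfun_approx measurableT mEf.
(* For a simple function both sides are finite sums over its values, and [gB] applies to each level
   set. Monotone convergence on both sides then gives the identity for [f]. *)
have hE n : (\int[mu]_w (g w * h n (phi w))%:E =
    c%:E * \int[nu]_x (h n x)%:E)%E.
  rewrite integralT_nnsfun sintegralE ge0_mule_fsumr; last first.
    by move=> y; exact: nnsfun_mulemu_ge0.
  transitivity (\int[mu]_w (\sum_(y \in range (h n))
      (y%:E * (g w * \1_(h n @^-1` [set y]) (phi w))%:E)))%E.
    apply: eq_integral => w _; rewrite {1}fimfunE EFinM -fsumEFin//.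
    rewrite ge0_mule_fsumr => [|y]; last exact: nnfun_muleindic_ge0.
    by apply: eq_fsbigr => y _; rewrite -!EFinM mulrCA.
  rewrite ge0_integral_fsum//.
  - apply: eq_fsbigr => y; rewrite inE => -[x _ <-].
    have mB : measurable (h n @^-1` [set h n x]).
      by rewrite -[X in measurable X]setTI; exact: measurable_funP.
    rewrite ge0_integralZl//.
    + by rewrite gB// muleCA.
    + apply/measurable_EFinP/measurable_funM => //.
      exact: measurableT_comp (measurable_indic mB) mphi.
    + by move=> w _; rewrite lee_fin mulr_ge0.
    + by rewrite lee_fin.
  - move=> y; apply/measurable_EFinP/measurable_funM => //.
    apply: measurable_funM => //.
    apply: measurableT_comp mphi; apply: measurable_indic.
    by rewrite -[X in measurable X]setTI; exact: measurable_funP.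
  - move=> y w _; rewrite EFinM muleCA mule_ge0 ?lee_fin//.
    exact: nnfun_muleindic_ge0.
have hcvg x : (h n x)%:E @[n --> \oo] --> (f x)%:E.
  by apply: (cvg_nnsfun_approx measurableT mEf) => // y _; rewrite lee_fin.
have hnd x : {homo (fun n => h n x) : n k / (n <= k)%N >-> (n <= k)%R}.
  by move=> n k nk; have /lefP := nd_nnsfun_approx measurableT mEf nk; exact.
have H1 : (\int[nu]_x (f x)%:E = limn (fun n => \int[nu]_x (h n x)%:E))%E.
  rewrite -monotone_convergence//.
  - by apply: eq_integral => x _; apply/esym/cvg_lim => //; exact: hcvg.
  - by move=> n; apply/measurable_EFinP; exact: measurable_funP.
  - by move=> n x _; rewrite lee_fin.
  - by move=> x _ n k nk; rewrite lee_fin; exact: hnd.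
have H2 : (\int[mu]_w (g w * f (phi w))%:E =
    limn (fun n => \int[mu]_w (g w * h n (phi w))%:E))%E.
  rewrite -monotone_convergence//.
  - apply: eq_integral => x _; apply/esym/cvg_lim => //.
    under eq_fun do rewrite EFinM; rewrite EFinM.
    by apply: cvgeZl => //; exact: hcvg.
  - move=> n; apply/measurable_EFinP/measurable_funM => //.
    by apply: measurableT_comp mphi; exact: measurable_funP.
  - by move=> n x _; rewrite lee_fin mulr_ge0.
  - by move=> x _ n k nk; rewrite lee_fin ler_wpM2l//; exact: hnd.
rewrite H1 H2 -limeMl//.
  by congr (limn _); apply/funext => n; exact: hE.
apply: ereal_nondecreasing_is_cvgn => n k nk.
apply: ge0_le_integral => //.
- by move=> x _; rewrite lee_fin.
- by apply/measurable_EFinP; exact: measurable_funP.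
- by apply/measurable_EFinP; exact: measurable_funP.
- by move=> x _; rewrite lee_fin; exact: hnd.
Qed.

Lemma measurable_coord m (d : 'I_m -> measure_display)
    (Omega : forall i, measurableType (d i)) (i : 'I_m) :
  measurable_fun setT (fun w : prod_space Omega => w i).
Proof.
move=> _ B mB; rewrite setTI; apply: sub_sigma_algebra.
by exists i, B.
Qed.

Lemma product_expectation m (d : 'I_m -> measure_display)
    (Omega : forall i, measurableType (d i))
    (P : forall i, probability (Omega i) R)
    (PP : probability (prod_space Omega) R) (f : forall i, Omega i -> R) :
  is_product_measure P PP ->
  (forall i, measurable_fun setT (f i)) -> (forall i x, 0 <= f i x) ->
  (forall i, \int[P i]_x (f i x)%:E < +oo)%E ->
  (\int[PP]_w (\prod_(i < m) f i (w i))%:E =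
   \prod_(i < m) \int[P i]_x (f i x)%:E)%E.
Proof.
move=> hPP mf f0 foo.
have ffin i : (\int[P i]_x (f i x)%:E)%E \is a fin_num.
  by rewrite ge0_fin_numE// integral_ge0// => x _; rewrite lee_fin.
(* The indicators of a box are replaced by the [f i] one coordinate at a
   time. *)
pose h k (A : forall i, set (Omega i)) (i : 'I_m) x : R :=
  if (i < k)%N then f i x else \1_(A i) x.
have mh k A i : measurable (A i) -> measurable_fun setT (h k A i).
  by move=> mA; rewrite /h; case: (i < k)%N => //; exact: measurable_indic.
have h0 k A i x : 0 <= h k A i x by rewrite /h; case: ifP.
suff H (k : nat) : (k <= m)%N -> forall A, (forall i, measurable (A i)) ->
    (\int[PP]_w (\prod_(i < m) h k A i (w i))%:E =
     \prod_(i < m) \int[P i]_x (h k A i x)%:E)%E.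
  have := H m (leqnn m) (fun=> setT) (fun=> measurableT).
  by rewrite /h; under eq_integral do under eq_bigr do rewrite ltn_ord;
    under [in RHS]eq_bigr do rewrite ltn_ord.
elim: k => [_ A mA|k IH km A mA].
  rewrite /h/=; under [RHS]eq_bigr do rewrite integral_indic// setIT.
  rewrite -hPP//.
  have mbox : measurable [set w : prod_space Omega | forall i, A i (w i)].
    rewrite (_ : mkset _ = \bigcap_(i in [set: 'I_m]) [set w | A i (w i)]).
      apply: fin_bigcap_measurable => [|i _]; first exact: finite_finset.
      by apply: sub_sigma_algebra; exists i, (A i).
    by apply: eq_set => w; apply: propext; split=> [+ i _|+ i]; apply.
  rewrite -[X in _ = PP X]setIT -integral_indic//; apply: eq_integral => w _.
  congr EFin; rewrite [RHS]indicE.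
  have [wA|/existsNP[i nA]] := pselect (forall i, A i (w i)).
    by rewrite mem_set// big1// => i _; rewrite indicE mem_set.
  rewrite memNset /=; last by move=> /(_ i).
  by rewrite (bigD1 i)//= indicE memNset// mul0r.
(* From [k] to [k.+1] only the coordinate [j] changes, from an indicator to [f j]. The other factors
   form the weight [g], and [c] is the product of their integrals. *)
pose j := Ordinal km.
have hj (i : 'I_m) (B : set (Omega j)) :
    i != j -> h k (eqtype.dfwith A B) i = h k.+1 A i.
  move=> ij; apply/funext => x; rewrite /h eqtype.dfwith_out 1?eq_sym//.
  by move: ij; rewrite -val_eqE/= ltnS [(i <= k)%N]leq_eqVlt => /negbTE ->.
have hfin i0 : (\int[P i0]_x (h k.+1 A i0 x)%:E \is a fin_num)%E.
  rewrite /h; case: (i0 < k.+1)%N => //; rewrite integral_indic// setIT.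
  exact: fin_num_measure.
pose g (w : prod_space Omega) := \prod_(i < m | i != j) h k.+1 A i (w i).
pose c := \prod_(i < m | i != j) fine (\int[P i]_x (h k.+1 A i x)%:E)%E.
have cE : (\prod_(i < m | i != j) \int[P i]_x (h k.+1 A i x)%:E = c%:E)%E.
  rewrite /c; apply: (big_ind2 (fun x y => x = y%:E)) => //.
    by move=> u1 u2 v1 v2 -> ->; rewrite EFinM.
  by move=> i _; rewrite fineK.
have hkj x1 : h k.+1 A j x1 = f j x1 by rewrite /h ltnS leqnn.
transitivity (\int[PP]_w (g w * f j (w j))%:E)%E.
  apply: eq_integral => w _; congr EFin.
  by rewrite (bigD1 j)//= hkj mulrC.
rewrite (bigD1 j)//= cE muleC; under [in RHS]eq_integral do rewrite hkj.
apply: ge0_integral_factor => //.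
- exact: measurable_coord.
- rewrite (_ : g = fun w => \prod_(i < m)
      if i != j then h k.+1 A i (w i) else 1); last first.
    by apply/funext => w; rewrite /g big_mkcond.
  apply: measurable_prod => i _; case: (i != j) => //.
  apply: (measurableT_comp _ (@measurable_coord m d Omega i)); exact: mh.
- by move=> w; apply: prodr_ge0.
- apply: prodr_ge0 => i _; apply: fine_ge0; apply: integral_ge0 => x _.
  by rewrite lee_fin.
move=> B mB.
have mAB i : measurable (eqtype.dfwith A B i).
  case: (eqVneq j i) => [<-|ji]; first by rewrite eqtype.dfwith_in.
  by rewrite eqtype.dfwith_out.
have hB x1 : h k (eqtype.dfwith A B) j x1 = \1_B x1.
  by rewrite /h ltnn eqtype.dfwith_in.
(* Replacing the side [A j] of the box by [B] turns this into an instance of the induction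
   hypothesis. *)
transitivity (\int[PP]_w (\prod_(i < m) h k (eqtype.dfwith A B) i (w i))%:E)%E.
  apply: eq_integral => w _; congr EFin.
  rewrite [RHS](bigD1 j)//= hB mulrC; congr (_ * _).
  by apply: eq_bigr => i ij; rewrite hj.
rewrite IH ?(ltnW km)// (bigD1 j)//= muleC; congr (_ * _)%E.
  by rewrite -cE; apply: eq_bigr => i ij; rewrite hj.
by under eq_integral do rewrite hB; rewrite integral_indic// setIT.
Qed.

End product.

(** * The psi_1 norm *)

Section psi1.
Context {R : realType} {d : measure_display} {Omega : measurableType d}.
Variable P : probability Omega R.

Lemma ge0_integral_lin (f g : Omega -> R) (a b : R) : 0 <= a -> 0 <= b ->
  measurable_fun setT f -> measurable_fun setT g ->
  (forall w, 0 <= f w) -> (forall w, 0 <= g w) ->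
  (\int[P]_w (a * f w + b * g w)%:E =
   a%:E * \int[P]_w (f w)%:E + b%:E * \int[P]_w (g w)%:E)%E.
Proof.
move=> a0 b0 mf mg f0 g0.
under eq_integral do rewrite EFinD EFinM EFinM.
have mEf : measurable_fun setT (EFin \o f) by exact/measurable_EFinP.
have mEg : measurable_fun setT (EFin \o g) by exact/measurable_EFinP.
rewrite ge0_integralD//.
- by rewrite !ge0_integralZl// => w _; rewrite lee_fin.
- by move=> w _; rewrite -EFinM lee_fin mulr_ge0.
- by apply: measurable_funeM.
- by move=> w _; rewrite -EFinM lee_fin mulr_ge0.
- by apply: measurable_funeM.
Qed.

Lemma ge0_integralZl_EFin (f : Omega -> R) (a : R) : 0 <= a ->
  measurable_fun setT f -> (forall w, 0 <= f w) ->
  (\int[P]_w (a * f w)%:E = a%:E * \int[P]_w (f w)%:E)%E.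
Proof.
move=> a0 mf f0; under eq_integral do rewrite EFinM.
rewrite ge0_integralZl//; first exact/measurable_EFinP.
by move=> w _; rewrite lee_fin.
Qed.

Lemma psi1_norm_ge0 (X : Omega -> R) : (0 <= psi1_norm P X)%E.
Proof.
by apply: le_ereal_inf_tmp => _ [a [a0 _] <-]; rewrite lee_fin ltW.
Qed.

Lemma psi1_norm_normE (X Y : Omega -> R) : (forall w, `|X w| = `|Y w|) ->
  psi1_norm P X = psi1_norm P Y.
Proof.
move=> XY; congr (ereal_inf (_ @` _)); apply/funext => a /=.
by rewrite unlock; under eq_integral do rewrite XY.
Qed.

(** Some scale [b < a] satisfies the defining bound, and the exponential moment decreases as the
    scale grows. *)
Lemma psi1_norm_lt (X : Omega -> R) (a : R) : measurable_fun setT X ->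
  (psi1_norm P X < a%:E)%E ->
  0 < a /\ (\int[P]_w (expR (`|X w| / a))%:E <= 2%:E)%E.
Proof.
move=> mX /ereal_inf_lt[_ [b [b0 Xb] <-]]; rewrite lte_fin => ba.
have a0 : 0 < a by exact: lt_trans ba.
split=> //.
have Eb : (\int[P]_w (expR (`|X w| / b))%:E <= 2%:E)%E.
  by move: Xb; rewrite unlock leeBlDr// -EFinD (_ : 1 + 1 = 2 :> R).
apply: le_trans Eb; apply: ge0_le_integral => //.
- apply/measurable_EFinP; apply: measurableT_comp => //.
  by apply: measurable_funM => //; exact: measurableT_comp.
- apply/measurable_EFinP; apply: measurableT_comp => //.
  by apply: measurable_funM => //; exact: measurableT_comp.
- move=> w _; rewrite lee_fin ler_expR ler_wpM2l//.
  by rewrite lef_pV2// ?posrE// ltW.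
Qed.

Lemma psi1_norm_le (X : Omega -> R) (a : R) : 0 < a ->
  (\int[P]_w (expR (`|X w| / a))%:E <= 2%:E)%E -> (psi1_norm P X <= a%:E)%E.
Proof.
move=> a0 Xa; apply: ereal_inf_lbound; exists a => //; split=> //.
by rewrite unlock leeBlDr// -EFinD (_ : 1 + 1 = 2 :> R).
Qed.

(** For scales [a], [b] slightly above the two norms, [(|X| + |Y|) / (a + b)] is the convex
    combination of [|X| / a] and [|Y| / b] with weights [a / (a + b)] and [b / (a + b)], so
    convexity of the exponential keeps the bound 2. *)
Lemma psi1_normD (X Y : Omega -> R) : measurable_fun setT X ->
  measurable_fun setT Y ->
  (psi1_norm P (X \+ Y)%R <= psi1_norm P X + psi1_norm P Y)%E.
Proof.
move=> mX mY.
have [->|Xoo] := eqVneq (psi1_norm P X) +oo%E.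
  by rewrite addye ?leey// gt_eqF// (lt_le_trans _ (psi1_norm_ge0 _)).
have [->|Yoo] := eqVneq (psi1_norm P Y) +oo%E.
  by rewrite addey ?leey// gt_eqF// (lt_le_trans _ (psi1_norm_ge0 _)).
apply/lee_addgt0Pr => e e0.
have Xf : psi1_norm P X \is a fin_num.
  by rewrite ge0_fin_numE ?psi1_norm_ge0// ltey.
have Yf : psi1_norm P Y \is a fin_num.
  by rewrite ge0_fin_numE ?psi1_norm_ge0// ltey.
pose a := fine (psi1_norm P X) + e / 2; pose b := fine (psi1_norm P Y) + e / 2.
have [|a0 Xa] := @psi1_norm_lt X a mX.
  by rewrite -(fineK Xf) lte_fin /a; lra.
have [|b0 Yb] := @psi1_norm_lt Y b mY.
  by rewrite -(fineK Yf) lte_fin /b; lra.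
rewrite -(fineK Xf) -(fineK Yf) -!EFinD.
rewrite (_ : _ + e = a + b); last by rewrite /a /b; lra.
have ab0 : 0 < a + b by exact: addr_gt0.
apply: psi1_norm_le => //.
pose r := a / (a + b).
have r01 : 0 <= r <= 1.
  by rewrite /r divr_ge0 ?(ltW a0) ?(ltW ab0)//= ler_pdivrMr// mul1r lerDl ltW.
have mE (Z : Omega -> R) c : measurable_fun setT Z ->
    measurable_fun setT (fun w => expR (`|Z w| / c)).
  move=> mZ; apply: measurableT_comp => //.
  by apply: measurable_funM => //; exact: measurableT_comp.
apply: (@le_trans _ _ (\int[P]_w
    (r * expR (`|X w| / a) + (1 - r) * expR (`|Y w| / b))%:E)%E).
  apply: ge0_le_integral => //.
  - by apply/measurable_EFinP/mE; exact: measurable_funD.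
  - by apply/measurable_EFinP/measurable_funD; apply: measurable_funM => //;
      exact: mE.
  - move=> w _; rewrite lee_fin.
    apply: (le_trans _ (expR_convex _ _ r01)).
    rewrite ler_expR.
    rewrite (_ : r * _ + _ = (`|X w| + `|Y w|) / (a + b)).
      by rewrite ler_wpM2r ?invr_ge0 ?(ltW ab0)// ler_normD.
    by rewrite /r; field; rewrite ?gt_eqF.
move: r01 => /andP[r0 r1].
have r1' : 0 <= 1 - r by lra.
rewrite ge0_integral_lin//; [|exact: mE|exact: mE].
have -> : 2%:E = (r%:E * 2%:E + (1 - r)%:E * 2%:E)%E :> \bar R.
  by rewrite -!EFinM -EFinD; congr EFin; ring.
apply: leeD.
- apply: lee_wpmul2l.
  + by rewrite lee_fin.
  + exact: Xa.
- apply: lee_wpmul2l.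
  + by rewrite lee_fin.
  + exact: Yb.
Qed.

(** [|X|] is dominated by [a * expR (|X| / a)] for any [a] above the norm. *)
Lemma psi1_norm_integrable (X : Omega -> R) : measurable_fun setT X ->
  (psi1_norm P X < +oo)%E -> P.-integrable setT (EFin \o X).
Proof.
move=> mX Xoo.
have Xf : psi1_norm P X \is a fin_num by rewrite ge0_fin_numE ?psi1_norm_ge0.
pose a := fine (psi1_norm P X) + 1.
have [|a0 Xa] := @psi1_norm_lt X a mX.
  by rewrite -(fineK Xf) lte_fin /a; lra.
have mE : measurable_fun setT (fun w => expR (`|X w| / a)).
  apply: measurableT_comp => //.
  by apply: measurable_funM => //; exact: measurableT_comp.
apply: (@le_integrable _ _ _ _ _ measurableT _
    (EFin \o (fun w => a * expR (`|X w| / a)))).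
- exact/measurable_EFinP.
- move=> w _; rewrite lee_fin [leRHS]ger0_norm; last first.
    by rewrite mulr_ge0// ?ltW// expR_ge0.
  rewrite mulrC -ler_pdivrMr//.
  by have := expR_ge1Dx (`|X w| / a); lra.
- apply/integrableP; split.
    by apply/measurable_EFinP/measurable_funM.
  apply: (@le_lt_trans _ _ (a%:E * 2%:E)%E); last by rewrite -EFinM ltry.
  under eq_integral do rewrite /= ger0_norm ?mulr_ge0 ?expR_ge0 ?(ltW a0)//.
  rewrite ge0_integralZl_EFin ?(ltW a0)//.
  by apply: lee_wpmul2l => //; rewrite lee_fin ltW.
Qed.

(* The infimum in [psi1_norm] need not be attained, so the bound is obtained
   in the limit [v -> psi1_norm P X]. *)
Lemma exp_rem_psi1 (X : Omega -> R) (theta : R) : measurable_fun setT X ->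
  (psi1_norm P X < +oo)%E ->
  0 <= theta -> theta * fine (psi1_norm P X) < 1 ->
  (\int[P]_w (exp_rem (`|theta * X w|))%:E
    <= (theta ^+ 2 * fine (psi1_norm P X) ^+ 2)%:E)%E.
Proof.
move=> mX Xoo th0 th1.
have Xf : psi1_norm P X \is a fin_num by rewrite ge0_fin_numE ?psi1_norm_ge0.
set psi := fine _ in th1 *.
have psi0 : 0 <= psi by rewrite fine_ge0// psi1_norm_ge0.
(* Scaling by [theta * v <= 1] leaves the remainder at [|X w| / v]. Its mean is at most 1, because
   [1 + exp_rem y <= expR y] for [y >= 0] and the exponential moment is at most 2. *)
have key v : psi < v -> theta * v <= 1 ->
    (\int[P]_w (exp_rem (`|theta * X w|))%:E <= (theta ^+ 2 * v ^+ 2)%:E)%E.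
  move=> pv thv.
  have [|v0 Xv] := @psi1_norm_lt X v mX.
    by rewrite -(fineK Xf) lte_fin.
  have mE : measurable_fun setT (fun w => exp_rem (`|X w| / v)).
    apply: measurableT_comp; first exact: measurable_exp_rem.
    by apply: measurable_funM => //; exact: measurableT_comp.
  apply: (@le_trans _ _
    (\int[P]_w ((theta * v) ^+ 2 * exp_rem (`|X w| / v))%:E)%E).
    apply: ge0_le_integral => //.
    - by move=> w _; rewrite lee_fin exp_rem_ge0.
    - apply/measurable_EFinP; apply: measurableT_comp.
        exact: measurable_exp_rem.
      by apply: measurableT_comp => //; exact: measurable_funM.
    - by apply/measurable_EFinP/measurable_funM.
    - move=> w _; rewrite lee_fin normrM ger0_norm//.
      have -> : theta * `|X w| = theta * v * (`|X w| / v).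
        by field; rewrite gt_eqF.
      apply: exp_rem_scale; last by rewrite divr_ge0// ltW.
      by rewrite thv andbT mulr_ge0// ltW.
  rewrite ge0_integralZl_EFin ?sqr_ge0//; last by move=> w; exact: exp_rem_ge0.
  rewrite -exprMn -[leRHS]mule1; apply: lee_wpmul2l.
    by rewrite lee_fin sqr_ge0.
  rewrite -(@leeD2rE _ 1%E)//.
  have := @ge0_integral_lin (fun w => exp_rem (`|X w| / v)) (cst 1) 1 1.
  have -> : (\int[P]_w (cst (1 : R) w)%:E = 1)%E.
    by rewrite (integral_cst P measurableT 1%E) mul1e; exact: probability_setT.
  rewrite !mul1e => <- //; last by move=> w; exact: exp_rem_ge0.
  rewrite (_ : (1 + 1 = 2%:E)%E); last by rewrite -EFinD.
  apply: le_trans Xv; apply: ge0_le_integral => //.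
  - by move=> w _; rewrite lee_fin !mul1r addr_ge0 ?exp_rem_ge0.
  - by apply/measurable_EFinP/measurable_funD; exact: measurable_funM.
  - apply/measurable_EFinP; apply: measurableT_comp => //.
    by apply: measurable_funM => //; exact: measurableT_comp.
  - move=> w _; rewrite lee_fin !mul1r /exp_rem/=.
    have : 0 <= `|X w| / v by rewrite divr_ge0// ltW.
    by move: (`|X w| / v) => z; lra.
have [th_eq0|th_neq0] := eqVneq theta 0.
  rewrite th_eq0; under eq_integral do
    rewrite mul0r normr0 /exp_rem expR0 !subr0 subrr.
  by rewrite integral0 expr0n/= mul0r.
have th_gt0 : 0 < theta by rewrite lt_neqAle eq_sym th_neq0.
apply/lee_addgt0Pr => e e0.
(* With [v ^+ 2 = psi ^+ 2 + e'], the first bound on [e'] keeps the error [theta ^+ 2 * e'] below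
   [e], and the second gives [theta * v <= 1]. *)
pose e' := Num.min (e / theta ^+ 2) (theta ^- 2 - psi ^+ 2).
have e'0 : 0 < e'.
  rewrite /e' lt_min divr_gt0 ?exprn_gt0//= subr_gt0.
  rewrite -exprVn ltrXn2r ?qualifE/= ?invr_ge0//.
  by rewrite -[ltRHS]mul1r ltr_pdivlMr// mulrC.
pose v := Num.sqrt (psi ^+ 2 + e').
have v2 : v ^+ 2 = psi ^+ 2 + e'.
  by rewrite sqr_sqrtr// addr_ge0 ?sqr_ge0// ltW.
apply: (le_trans (key v _ _)).
- rewrite -(@ltr_pXn2r _ 2)// ?nnegrE ?sqrtr_ge0// v2; lra.
- rewrite -(@ler_pXn2r _ 2)// ?nnegrE ?mulr_ge0 ?sqrtr_ge0//.
  rewrite exprMn v2 expr1n mulrC -ler_pdivlMr ?exprn_gt0// mul1r.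
  have : e' <= theta ^- 2 - psi ^+ 2 by rewrite ge_min lexx orbT.
  lra.
- rewrite v2 mulrDr -EFinD lee_fin lerD2l mulrC -ler_pdivlMr ?exprn_gt0//.
  by rewrite ge_min lexx.
Qed.

(** [expR W] is at most [1 + W + exp_rem |W|], whose mean is at most [1 + mu + c <= expR (mu + c)];
    the factor [expR (- mu)] from the centring cancels [mu]. *)
Lemma integral_expR_centered (W : Omega -> R) (c : R) :
  P.-integrable setT (EFin \o W) ->
  (\int[P]_w (exp_rem `|W w|)%:E <= c%:E)%E ->
  (\int[P]_w (expR (W w - fine 'E_P[W]))%:E <= (expR c)%:E)%E.
Proof.
move=> iW Wc.
have mW : measurable_fun setT W by apply/measurable_EFinP; case/integrableP: iW.
have mr : measurable_fun setT (EFin \o (fun w => exp_rem `|W w|)).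
  apply/measurable_EFinP; apply: (measurableT_comp (@measurable_exp_rem R)).
  exact: measurableT_comp.
set mu := fine _.
have EW : (\int[P]_w (W w)%:E = mu%:E)%E.
  by rewrite /mu unlock fineK//; exact: integrable_fin_num.
have ir : P.-integrable setT (EFin \o (fun w => exp_rem `|W w|)).
  apply/integrableP; split => //; apply: le_lt_trans (ltry c).
  by under eq_integral => w _ do rewrite /= ger0_norm ?exp_rem_ge0//.
have i1 : P.-integrable setT (EFin \o cst (1 : R)).
  exact: finite_measure_integrable_cst.
apply: (@le_trans _ _ (\int[P]_w ((expR (- mu))%:E *
    (1 + (W w)%:E + (exp_rem `|W w|)%:E)))%E).
  apply: ge0_le_integral => //.
  - apply/measurable_EFinP; apply: measurableT_comp => //.
    exact: measurable_funB.
  - apply/measurable_EFinP/measurable_funM => //; apply: measurable_funD.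
      exact: measurable_funD.
    exact/measurable_EFinP.
  - move=> w _; rewrite -!EFinD -EFinM lee_fin.
    rewrite [W w - mu]addrC expRD ler_pM2l ?expR_gt0//.
    by have := exp_rem_norm (W w); rewrite {1}/exp_rem; lra.
rewrite integralZl//; last first.
  by apply: integrableD => //; exact: integrableD.
rewrite integralD//; last exact: integrableD.
rewrite integralD//.
have -> : (\int[P]_w (1%:E : \bar R) = 1)%E.
  by rewrite (integral_cst P measurableT 1%E) mul1e; exact: probability_setT.
rewrite EW.
apply: (@le_trans _ _ ((expR (- mu))%:E * (1 + mu%:E + c%:E))%E).
  by apply: lee_wpmul2l; rewrite ?lee_fin ?expR_ge0// leeD.
rewrite -!EFinD -EFinM lee_fin mulrC expRN ler_pdivrMr ?expR_gt0// -expRD.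
by have := expR_ge1Dx (c + mu); lra.
Qed.

End psi1.

(** * Exponential moments of the empirical process *)

Section bernstein.
Variables (R : realType) (m : nat) (d : 'I_m -> measure_display).
Variables (Omega : forall i, measurableType (d i)).
Variables (P : forall i, probability (Omega i) R).
Variables (PP : probability (prod_space Omega) R).
Hypothesis hPP : is_product_measure P PP.

Lemma measurable_sum_coord (V : forall i, Omega i -> R) :
  (forall i, measurable_fun setT (V i)) ->
  measurable_fun setT (fun w : prod_space Omega => \sum_(i < m) V i (w i)).
Proof.
move=> mV; apply: measurable_sum => i.
by apply: (measurableT_comp (mV i)); exact: measurable_coord.
Qed.

Lemma integral_expR_sum (V : forall i, Omega i -> R) (c : 'I_m -> R) :
  (forall i, measurable_fun setT (V i)) ->
  (forall i, \int[P i]_x (expR (V i x))%:E <= (expR (c i))%:E)%E ->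
  (\int[PP]_w (expR (\sum_(i < m) V i (w i)))%:E <=
   (expR (\sum_(i < m) c i))%:E)%E.
Proof.
move=> mV Vc.
under eq_integral do rewrite expR_sum.
rewrite (product_expectation (f := fun i x => expR (V i x)) hPP)//.
- rewrite expR_sum -prodEFin.
  (* Nonnegativity is carried along, since multiplying the inequalities requires it. *)
  apply: (@proj2 (0 <= \prod_(i < m) \int[P i]_x (expR (V i x))%:E)%E).
  apply: (big_ind2 (fun x y : \bar R => 0 <= x /\ x <= y)%E) => //.
    move=> x1 x2 y1 y2 [x10 x12] [y10 y12]; split; first exact: mule_ge0.
    exact: lee_pmul.
  move=> i _; split => //; apply: integral_ge0 => x _.
  by rewrite lee_fin expR_ge0.
- by move=> i; exact: measurableT_comp.
- by move=> i; exact: le_lt_trans (Vc i) (ltry _).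
Qed.

(** The factor 2 comes from [expR |x| <= expR x + expR (- x)]. *)
Lemma integral_expR_norm_sum (V : forall i, Omega i -> R) (c : 'I_m -> R) :
  (forall i, measurable_fun setT (V i)) ->
  (forall i, \int[P i]_x (expR (V i x))%:E <= (expR (c i))%:E)%E ->
  (forall i, \int[P i]_x (expR (- V i x))%:E <= (expR (c i))%:E)%E ->
  (\int[PP]_w (expR `|\sum_(i < m) V i (w i)|)%:E <=
   (2 * expR (\sum_(i < m) c i))%:E)%E.
Proof.
move=> mV Vc NVc.
have mS := measurable_sum_coord mV.
have mNV i : measurable_fun setT (fun x => - V i x) by exact: measurableT_comp.
have mNS := measurable_sum_coord mNV.
apply: (@le_trans _ _ (\int[PP]_w (1 * expR (\sum_(i < m) V i (w i)) +
    1 * expR (\sum_(i < m) - V i (w i)))%:E)%E).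
  apply: ge0_le_integral => //.
  - apply/measurable_EFinP; apply: measurableT_comp => //.
    exact: measurableT_comp.
  - apply/measurable_EFinP/measurable_funD; apply: measurable_funM => //.
      exact: measurableT_comp.
    apply: measurableT_comp => //.
  - move=> w _; rewrite lee_fin sumrN !mul1r.
    move: (\sum_(i < m) _) => x; have := expR_gt0 x; have := expR_gt0 (- x).
    by case: (ler0P x) => _; lra.
rewrite ge0_integral_lin//.
- rewrite !mul1e mulr_natl mulr2n EFinD; apply: leeD.
  + exact: integral_expR_sum mV Vc.
  + exact: integral_expR_sum mNV NVc.
- exact: measurableT_comp.
- apply: measurableT_comp => //.
Qed.

Variables (S : Type) (X : forall i, S -> {RV (P i) >-> R}).

Let psi i (s t : m.-tuple S) := fine (increment_psi1 X i s t).

Lemma measurable_emp t : measurable_fun setT (emp X t).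
Proof.
apply: measurable_funM => //.
apply: (measurable_sum_coord (V := fun i => centered X (tnth t i))) => i.
exact: measurable_funB.
Qed.

Lemma increment_psi1_fin i s t : 
  subexponential (P i) (X i (tnth s i)) ->
  subexponential (P i) (X i (tnth t i)) ->
  increment_psi1 X i s t \is a fin_num.
Proof.
move=> Xs Xt; rewrite ge0_fin_numE ?psi1_norm_ge0//.
apply: le_lt_trans (psi1_normD _ _ _) _ => //.
  exact: measurableT_comp.
rewrite lte_add_pinfty// (@psi1_norm_normE _ _ _ _ _ (X i (tnth s i)))//.
by move=> w /=; rewrite normrN.
Qed.

(** The centred bound is applied to [theta * W], where [W] is the uncentred increment. Both signs of
    [theta] are covered because the modulus of the sum calls for both. *)
Lemma integral_expR_increment i s t (theta : R) :
  subexponential (P i) (X i (tnth s i)) ->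
  subexponential (P i) (X i (tnth t i)) ->
  `|theta| * psi i s t < 1 ->
  (\int[P i]_x
    (expR (theta * (centered X (tnth t i) x - centered X (tnth s i) x)))%:E
   <= (expR (theta ^+ 2 * psi i s t ^+ 2))%:E)%E.
Proof.
move=> Xs Xt th1.
have Xf := increment_psi1_fin Xs Xt.
have iX a : subexponential (P i) (X i a) ->
    (P i).-integrable setT (EFin \o (X i a : _ -> R)).
  by move=> Xa; exact: psi1_norm_integrable.
pose W := (X i (tnth t i) \- X i (tnth s i))%R : Omega i -> R.
have mW : measurable_fun setT W by exact: measurable_funB.
have iW : (P i).-integrable setT (EFin \o W).
  apply: psi1_norm_integrable mW _.
  by rewrite -ge0_fin_numE; [exact: Xf|exact: psi1_norm_ge0].
have EW : ('E_(P i)[W] =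
    'E_(P i)[X i (tnth t i)] - 'E_(P i)[X i (tnth s i)])%E.
  by rewrite expectationB//; apply/Lfun1_integrable; exact: iX.
have Ef a : subexponential (P i) (X i a) -> ('E_(P i)[X i a])%E \is a fin_num.
  by move=> Xa; apply: expectation_fin_num; apply/Lfun1_integrable; exact: iX.
have iZ : (P i).-integrable setT (EFin \o (fun w => theta * W w)).
  exact: (integrableZl measurableT theta iW).
have EZ : ('E_(P i)[fun w => (theta * W w)%R] = theta%:E * 'E_(P i)[W])%E.
  rewrite -expectationZl; last exact/Lfun1_integrable.
  by congr expectation.body; apply/funext => w; rewrite /= mulrC.
under eq_integral => w _.
  rewrite (_ : theta * _ =
      theta * W w - fine ('E_(P i)[fun w => (theta * W w)%R])%E).
    over.
  rewrite EZ EW -(fineK (Ef _ Xs)) -(fineK (Ef _ Xt)) /= /centered /W /=.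
  ring.
apply: integral_expR_centered => //.
rewrite (_ : (fun w => (exp_rem `|theta * W w|)%:E) =
    (fun w => (exp_rem `| `|theta| * W w|)%:E)); last first.
  by apply/funext => w; rewrite !normrM normr_id.
rewrite -[theta ^+ 2]real_normK ?num_real//.
apply: exp_rem_psi1 => //; first by rewrite -ge0_fin_numE// psi1_norm_ge0.
Qed.

Lemma integral_expR_emp_increment s t (lambda : R) : (0 < m)%N ->
  (forall i, subexponential (P i) (X i (tnth s i))) ->
  (forall i, subexponential (P i) (X i (tnth t i))) ->
  0 <= lambda -> (forall i, lambda / m%:R * psi i s t < 1) ->
  (\int[PP]_w (expR (lambda * `|emp X t w - emp X s w|))%:E
   <= (2 * expR ((lambda / m%:R) ^+ 2 * \sum_(i < m) psi i s t ^+ 2))%:E)%E.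
Proof.
move=> m0 Xs Xt l0 l1; set th := lambda / m%:R.
have th0 : 0 <= th by rewrite divr_ge0.
pose V i (x : Omega i) :=
  th * (centered X (tnth t i) x - centered X (tnth s i) x).
rewrite (eq_integral
    (fun w : prod_space Omega => (expR `|\sum_(i < m) V i (w i)|)%:E));
  last first.
  move=> w _; congr (expR _)%:E.
  rewrite -mulr_sumr normrM ger0_norm// /emp -mulrBr -sumrB normrM.
  by rewrite ger0_norm ?invr_ge0// mulrA.
rewrite mulr_sumr; apply: integral_expR_norm_sum.
- move=> i; apply: measurable_funM => //; apply: measurable_funB;
    exact: measurable_funB.
- by move=> i; apply: integral_expR_increment => //; rewrite ger0_norm.
- move=> i; rewrite -[th ^+ 2]sqrrN; rewrite /V.
  under eq_integral do rewrite -mulNr.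
  by apply: integral_expR_increment => //; rewrite normrN ger0_norm.
Qed.

(** The moments are controlled only on average over [i], so the [r i] are bounded through their sum.
    Expanded in powers, its term of order [q] is at most [lambda ^ 2 * sigma ^ 2 / m] times
    [2^-1 * (th * K) ^ (q - 2)], and [th * K <= 1/2] makes the series geometric. *)
Lemma integral_expR_emp t (sigma K lambda : R) : (0 < m)%N ->
  (forall i, subexponential (P i) (X i (tnth t i))) ->
  0 < sigma -> 0 < K ->
  (forall q : nat, (2 <= q)%N ->
    (m%:R^-1)%:E *
      \sum_(i < m) 'E_(P i)[fun w => (`|centered X (tnth t i) w| ^+ q)%R]
    <= (q`!%:R / 2 * sigma ^+ 2 * K ^+ (q - 2))%:E)%E ->
  0 <= lambda -> lambda / m%:R * K <= 2^-1 ->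
  (\int[PP]_w (expR (lambda * `|emp X t w|))%:E
   <= (2 * expR (lambda ^+ 2 * sigma ^+ 2 / m%:R))%:E)%E.
Proof.
move=> m0 Xt s0 K0 mom l0 lK; set th := lambda / m%:R.
have th0 : 0 <= th by rewrite divr_ge0.
pose Y i := centered X (tnth t i) : Omega i -> R.
have mY i : measurable_fun setT (Y i) by exact: measurable_funB.
pose r i := (\int[P i]_x (exp_rem `|th * Y i x|)%:E)%E.
have r0 i : (0 <= r i)%E.
  by apply: integral_ge0 => x _; rewrite lee_fin exp_rem_ge0.
have rsum : (\sum_(i < m) r i <= (lambda ^+ 2 * sigma ^+ 2 / m%:R)%:E)%E.
  pose a q : R := th ^+ q / q`!%:R.
  have a0 q : 0 <= a q by rewrite divr_ge0// exprn_ge0.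
  pose M i q := (\int[P i]_x (`|Y i x| ^+ q)%:E)%E.
  have M0 i q : (0 <= M i q)%E.
    by apply: integral_ge0 => x _; rewrite lee_fin exprn_ge0.
  have rE i : (r i = \sum_(2 <= q <oo) (a q)%:E * M i q)%E.
    rewrite /r; under eq_integral do rewrite exp_rem_series//.
    rewrite integral_nneseries_from; first last.
    - by move=> q x; rewrite lee_fin divr_ge0// exprn_ge0.
    - move=> q; apply/measurable_EFinP; apply: measurable_funM => //.
      apply: measurable_funX; apply: measurableT_comp => //.
      exact: measurable_funM.
    apply: eq_eseriesr => q _; rewrite -ge0_integralZl_EFin//.
    - apply: eq_integral => x _; congr EFin.
      by rewrite normrM (ger0_norm th0) exprMn /a mulrAC.
    - by apply: measurable_funX; apply: measurableT_comp => //; exact: mY.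
  under eq_bigr do rewrite rE.
  rewrite -nneseries_sum; last by move=> i q _; rewrite mule_ge0// lee_fin.
  have c0 : 0 <= lambda ^+ 2 * sigma ^+ 2 / m%:R.
    by rewrite divr_ge0// mulr_ge0// sqr_ge0.
  apply: le_trans (nneseries_geometric_le c0).
  rewrite eseries_cond [leRHS]eseries_cond/=.
  apply: lee_nneseries => [q _ _|q q2].
    by apply: sume_ge0 => i _; rewrite mule_ge0// lee_fin.
  rewrite -ge0_sume_distrr; last by move=> i _; exact: M0.
  have mR0 : 0 < m%:R :> R by rewrite ltr0n.
  have MK : (\sum_(i < m) M i q <=
      (m%:R * (q`!%:R / 2 * sigma ^+ 2 * K ^+ (q - 2)))%:E)%E.
    have := mom q q2; under eq_bigr do rewrite unlock.
    rewrite -(@lee_pmul2l _ m%:R%:E) ?lte_fin//= muleA -!EFinM.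
    by rewrite mulfV ?gt_eqF// mul1e.
  apply: (le_trans (lee_wpmul2l _ MK)); first by rewrite lee_fin.
  rewrite -EFinM lee_fin.
  have -> : a q * (m%:R * (q`!%:R / 2 * sigma ^+ 2 * K ^+ (q - 2))) =
      lambda ^+ 2 * sigma ^+ 2 / m%:R * (2^-1 * (th * K) ^+ (q - 2)).
    have -> : a q = th ^+ (q - 2) * th ^+ 2 / q`!%:R by rewrite -exprD subnK.
    rewrite [(th * K) ^+ _]exprMn; move: (th ^+ (q - 2)) (K ^+ (q - 2)) => A B.
    by rewrite /th; field; rewrite !gt_eqF ?ltr0n ?fact_gt0.
  apply: ler_wpM2l => //.
  have -> : 2 * 2^-1 ^+ q = 2^-1 * 2^-1 ^+ (q - 2) :> R.
    by rewrite -{1}(subnK q2) exprD; field.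
  apply: ler_wpM2l => //.
  by apply: lerXn2r; rewrite ?nnegrE ?mulr_ge0 ?(ltW K0).
(* Each summand is nonnegative and the sum is finite. *)
have rfin i : r i \is a fin_num.
  rewrite ge0_fin_numE//.
  apply: le_lt_trans (ltry (lambda ^+ 2 * sigma ^+ 2 / m%:R)).
  by apply: le_trans rsum; rewrite (bigD1 i)//= leeDl// sume_ge0.
have iX i : (P i).-integrable setT (EFin \o (X i (tnth t i) : _ -> R)).
  by apply: psi1_norm_integrable => //; exact: Xt.
have iY i : (P i).-integrable setT (EFin \o Y i).
  exact: (integrableB measurableT (iX i) (finite_measure_integrable_cst (P i)
    (fine ('E_(P i)[X i (tnth t i)])%E) measurableT)).
have EY i : ('E_(P i)[Y i] = 0)%E.
  have -> : Y i = (X i (tnth t i) \-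
    cst (fine ('E_(P i)[X i (tnth t i)])%E))%R by [].
  have fE : ('E_(P i)[X i (tnth t i)])%E \is a fin_num.
    by apply: expectation_fin_num; apply/Lfun1_integrable.
  rewrite expectationB; first last.
  - by apply/Lfun1_integrable; exact: finite_measure_integrable_cst.
  - exact/Lfun1_integrable.
  by rewrite expectation_cst fineK// subee.
(* Here [a] is [th] or [- th]; since [Y i] has mean 0, the centring term vanishes. *)
have thY (a : R) i : `|a| = th ->
    (\int[P i]_x (expR (a * Y i x))%:E <= (expR (fine (r i)))%:E)%E.
  move=> ath.
  have iaY : (P i).-integrable setT (EFin \o (fun w => a * Y i w)).
    exact: (integrableZl measurableT a (iY i)).
  have EaY : ('E_(P i)[fun w => (a * Y i w)%R] = 0)%E.
    rewrite -[RHS](mule0 a%:E) -(EY i) -expectationZl.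
      by congr expectation.body; apply/funext => w; rewrite /= mulrC.
    exact/Lfun1_integrable.
  rewrite (eq_integral (fun x =>
      (expR (a * Y i x - fine ('E_(P i)[fun w => (a * Y i w)%R])%E))%:E));
    last first.
    by move=> x _; rewrite EaY subr0.
  apply: integral_expR_centered => //; rewrite fineK// /r.
  by under eq_integral do rewrite normrM ath -[th]ger0_norm// -normrM.
rewrite (eq_integral (fun w : prod_space Omega =>
    (expR `|\sum_(i < m) th * Y i (w i)|)%:E)); last first.
  move=> w _; congr (expR _)%:E.
  rewrite -mulr_sumr [`|th * _|]normrM (ger0_norm th0).
  by rewrite /emp normrM [`|m%:R^-1|]ger0_norm ?invr_ge0// mulrA.
apply: (le_trans (integral_expR_norm_sum (V := fun i x => th * Y i x)
    (c := fun i => fine (r i)) _ _ _)).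
- by move=> i; exact: measurable_funM.
- by move=> i; apply: thY; rewrite ger0_norm.
- move=> i; under eq_integral do rewrite -mulNr.
  by apply: thY; rewrite normrN ger0_norm.
rewrite lee_fin ler_pM2l// ler_expR -lee_fin -sumEFin.
by under eq_bigr do rewrite fineK//.
Qed.


End bernstein.

(** * Chains of cells *)

Section chaining.
Variables (R : realType) (J : finType).
Implicit Types (dist : J -> J -> R) (n : nat).

(** The factor 2 lets [d_2] be handled by [(y + z) ^ 2 <= 2 * y ^ 2 + 2 * z ^ 2] instead of
    Minkowski's inequality. Having [a] second in both terms builds symmetry into the inequality. *)
Definition quasi_metric dist :=
  forall s t a, dist s t <= 2 * (dist s a + dist t a).

(* [a n t] stands for a point of the n-th set of an admissible sequence which
   is almost nearest to [t]; the weight [b ^+ n] is 2^(n/alpha). *)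
Definition approximation dist (b G : R) (a : nat -> J -> J)
    (r : nat -> J -> R) :=
  [/\ forall n t, dist t (a n t) <= r n t,
      forall n t, 0 <= r n t,
      forall N t, \sum_(n < N) b ^+ n * r n t <= G &
      forall n, (#|[set a n t | t : J]%SET| <= 2 ^ (2 ^ n))%N].

(** Points [s], [t] of a cell lie within [r n s] and [r n t] of the same point, and [r n s] exceeds
    [r n t] by at most the bucket width [G / (2 * b) ^+ n]. The outer 2 is the quasi-metric
    constant. *)
Definition cell_radius (b G : R) (r : nat -> J -> R) n t :=
  2 * (2 * r n t + G / (2 * b) ^+ n).

Lemma sum_halves (N : nat) : \sum_(n < N) 2^-1 ^+ n.+1 <= 1 :> R.
Proof.
suff -> : \sum_(n < N) 2^-1 ^+ n.+1 = 1 - 2^-1 ^+ N :> R.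
  by rewrite lerBlDr lerDl.
elim: N => [|N IH]; first by rewrite big_ord0 expr0 subrr.
by rewrite big_ord_recr//= IH !exprS; field.
Qed.

(** The distances contribute [4 * G]. The bucket widths, once weighted by [b ^+ n], form a geometric
    series and contribute another [4 * G]. *)
Lemma sum_cell_radius (b G : R) (r : nat -> J -> R) (N : nat) t :
  0 < b -> 0 <= G -> \sum_(n < N) b ^+ n * r n t <= G ->
  \sum_(n < N) b ^+ n * cell_radius b G r n t <= 8 * G.
Proof.
move=> b0 G0 rG.
have -> : \sum_(n < N) b ^+ n * cell_radius b G r n t =
    4 * (\sum_(n < N) b ^+ n * r n t) + 4 * G * \sum_(n < N) 2^-1 ^+ n.+1.
  rewrite !mulr_sumr -big_split/=; apply: eq_bigr => n _.
  rewrite /cell_radius exprMn exprS exprVn; field.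
  by rewrite !expf_neq0// gt_eqF.
have := ler_wpM2l G0 (sum_halves N).
by move: (\sum_(n < N) 2^-1 ^+ _) => x; lra.
Qed.

(** When [b ^+ n * r n t <= G] the quotient is at most [2 ^ n], so [inord] does not fall back to its
    default. *)
Definition bucket (b G : R) (r : nat -> J -> R) n t : 'I_(2 ^ n).+1 :=
  inord (Num.truncn ((2 * b) ^+ n * r n t / G)).

Lemma bucket_close (b G : R) (r : nat -> J -> R) n s t : 0 < b -> 0 < G ->
  (forall t, 0 <= r n t) -> (forall t, b ^+ n * r n t <= G) ->
  bucket b G r n s = bucket b G r n t -> r n s <= r n t + G / (2 * b) ^+ n.
Proof.
move=> b0 G0 r0 rG.
pose x u := (2 * b) ^+ n * r n u / G.
have B0 : 0 < (2 * b) ^+ n by rewrite exprn_gt0// mulr_gt0.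
have x0 u : 0 <= x u by rewrite divr_ge0 ?(ltW G0)// mulr_ge0// ltW.
have xn u : (Num.truncn (x u) < (2 ^ n).+1)%N.
  rewrite ltnS truncn_le_nat; apply: (@le_lt_trans _ _ (2 ^ n)%:R); last first.
    by rewrite ltr_nat.
  rewrite /x ler_pdivrMr// exprMn natrX -mulrA ler_wpM2l//.
move=> /(congr1 val); rewrite /= !inordK ?xn// -!/(x _) => E.
have : x s <= x t + 1.
  have /andP[_ xs] := truncn_itv (x0 s); have /andP[xt _] := truncn_itv (x0 t).
  by move: xs; rewrite E -natr1; move: xt; lra.
have g0 : 0 < G / (2 * b) ^+ n by exact: divr_gt0.
have rE u : r n u = x u * (G / (2 * b) ^+ n).
  by rewrite /x; field; rewrite (gt_eqF B0) (gt_eqF G0).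
move=> xst; have := ler_wpM2r (ltW g0) xst.
by rewrite [(x t + 1) * _]mulrDl mul1r (rE s) (rE t).
Qed.

Lemma cell_dist dist (b G : R) a r n s t : 0 < b -> 0 < G ->
  quasi_metric dist -> approximation dist b G a r ->
  a n s = a n t -> bucket b G r n s = bucket b G r n t ->
  dist s t <= cell_radius b G r n t.
Proof.
move=> b0 G0 qd [da r0 rG _] ast bst.
have rn u : b ^+ n * r n u <= G.
  apply: le_trans (rG n.+1 u); rewrite big_ord_recr/= lerDr sumr_ge0// => i _.
  by rewrite mulr_ge0// exprn_ge0// ltW.
have := bucket_close b0 G0 (r0 n) rn bst.
have := qd s t (a n s); have := da n s; rewrite {3}ast; have := da n t.
by rewrite /cell_radius; move: (G / _) => g; lra.
Qed.

(* Distances to an admissible sequence of sets do not control the diameter of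
   the cells of points sharing the same nearest point, so a cell also fixes
   these distances, rounded to one of [2 ^ n + 1] values. *)
Lemma chain_selection dist1 dist2 (b1 b2 G1 G2 : R) a1 a2 r1 r2 :
  0 < b1 -> 0 < b2 -> 0 < G1 -> 0 < G2 ->
  quasi_metric dist1 -> quasi_metric dist2 ->
  approximation dist1 b1 G1 a1 r1 -> approximation dist2 b2 G2 a2 r2 ->
  exists (pi : nat -> J -> J) (L : nat),
    [/\ forall n, (#|[set pi n t | t : J]%SET| <= 2 ^ (4 * 2 ^ n))%N,
        forall n t, (L <= n)%N -> pi n t = t,
        forall N t, \sum_(n < N) b1 ^+ n * dist1 (pi n t) t <= 8 * G1 &
        forall N t, \sum_(n < N) b2 ^+ n * dist2 (pi n t) t <= 8 * G2].
Proof.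
move=> b10 b20 G10 G20 q1 q2 ap1 ap2.
pose code n t := ((a1 n t, bucket b1 G1 r1 n t), (a2 n t, bucket b2 G2 r2 n t)).
pose rep n (c : (J * 'I_(2 ^ n).+1) * (J * 'I_(2 ^ n).+1)) (t : J) :=
  odflt t [pick s | code n s == c].
(* From level [#|J|] on, [pi] is the identity, so every chain reaches its end point; the cardinality
   bound holds there since [n <= 2 ^ n]. *)
pose L := #|J|.
pose pi n t := if (L <= n)%N then t else rep n (code n t) t.
have code_pi n t : code n (pi n t) = code n t.
  rewrite /pi; case: ifP => // _; rewrite /rep; case: pickP => [s /eqP //|].
  by move=> /(_ t); rewrite eqxx.
exists pi, L; split.
- move=> n; rewrite /pi; case: (leqP L n) => [Ln|nL].
    apply: leq_trans (max_card _) (leq_trans Ln _).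
    have n2n k : (k <= 2 ^ k)%N by exact/ltnW/ltn_expl.
    apply: leq_trans (n2n n) _; rewrite leq_exp2l//.
    by apply: leq_trans (n2n n) _; rewrite leq_pmull.
  have [t0 _|J0] := pickP (fun _ : J => true); last first.
    by move: nL; rewrite /L eq_card0// => s; have := J0 s.
  pose A1 := ([set a1 n t | t : J])%SET; pose A2 := ([set a2 n t | t : J])%SET.
  pose K := ([set: 'I_(2 ^ n).+1])%SET.
  pose B := finset.setX (finset.setX A1 K) (finset.setX A2 K).
  (* Codes attained by a point never reach the default of [rep], so a fixed [t0] can replace [t] and
     the image is indexed by codes alone. *)
  have sub : ([set rep n (code n t) t | t : J] \subset
      [set rep n c t0 | c in B])%SET.
    apply/fintype.subsetP => _ /imsetP[t _ ->]; apply/imsetP; exists (code n t).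
      by rewrite !inE/= !andbT; apply/andP; split; apply: imset_f.
    by rewrite /rep; case: pickP => // /(_ t); rewrite eqxx.
  apply: leq_trans (subset_leq_card sub) _.
  apply: leq_trans (leq_imset_card _ _) _.
  rewrite /B /K !cardsX !cardsT card_ord.
  (* Two choices of a point and two of a bucket, each among at most [2 ^ (2 ^ n)], account for the
     exponent [4 * 2 ^ n]. *)
  have two : ((2 ^ n).+1 <= 2 ^ (2 ^ n))%N by exact: ltn_expl.
  have [_ _ _ c1] := ap1; have [_ _ _ c2] := ap2.
  rewrite (_ : 4 * 2 ^ n = (2 ^ n + 2 ^ n) + (2 ^ n + 2 ^ n))%N; last first.
    by rewrite !addnn -!mul2n mulnA.
  rewrite !expnD; apply: leq_mul; apply: leq_mul; rewrite ?two ?c1 ?c2//.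
- by move=> n t Ln; rewrite /pi Ln.
- move=> N t; have [_ _ s1 _] := ap1.
  apply: le_trans (sum_cell_radius b10 (ltW G10) (s1 N t)).
  apply: ler_sum => n _; apply: ler_wpM2l; first by rewrite exprn_ge0// ltW.
  by apply: (cell_dist b10 G10 q1 ap1); have [] := code_pi n t.
- move=> N t; have [_ _ s2 _] := ap2.
  apply: le_trans (sum_cell_radius b20 (ltW G20) (s2 N t)).
  apply: ler_sum => n _; apply: ler_wpM2l; first by rewrite exprn_ge0// ltW.
  by apply: (cell_dist b20 G20 q2 ap2); have [] := code_pi n t.
Qed.

End chaining.

(** [U] is a bare type; indexing by ordinals provides the [finType] on which the chaining is carried
    out. *)
Lemma finite_set_enumeration (U : Type) (T : set U) : finite_set T ->
  exists k (e : 'I_k -> U), [/\ injective e, forall j, T (e j) &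
    forall t, T t -> exists j, e j = t].
Proof.
move=> /finite_setP[k /card_set_bijP[f [fT finj fsurj]]].
have ex (j : 'I_k) : exists t, T t /\ f t = j.
  by have [t Tt ft] := fsurj j (ltn_ord j); exists t.
have [e eP] := choice ex.
exists k, e; split.
- by move=> i j eij; apply: val_inj; rewrite /= -(eP i).2 -(eP j).2 eij.
- by move=> j; exact: (eP j).1.
- move=> t Tt; exists (Ordinal (fT t Tt)).
  by apply: finj; rewrite ?inE ?(eP _).2//; exact: (eP _).1.
Qed.

Lemma card_imset_admissible (U : Type) (A : set U) (J : finType) (e : J -> U)
    (a : J -> J) (k : nat) : (0 < k)%N -> injective e ->
  (forall t, A (e (a t))) -> (A #<= `I_k)%card ->
  (#|[set a t | t : J]%SET| <= k)%N.
Proof.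
case: k => // k _ einj Aa /card_leP[g].
have gk x (h : A x) : (val (g (SigSub (mem_set h))) < k.+1)%N.
  exact: (set_valP (g (SigSub (mem_set h)))).
(* The value [ord0] outside [A] is irrelevant: injectivity is needed only on the image of [a], which
   [e] maps into [A]. *)
pose f (j : J) : 'I_k.+1 :=
  if pselect (A (e j)) is left h then inord (val (g (SigSub (mem_set h))))
  else ord0.
have finj : {in [set a t | t : J]%SET &, injective f}.
  move=> _ _ /imsetP[s _ ->] /imsetP[t _ ->]; rewrite /f.
  case: pselect => [hs|/(_ (Aa s))//]; case: pselect => [ht|/(_ (Aa t))//].
  move=> /(congr1 val); rewrite /= !inordK ?gk//.
  move=> /val_inj gst; apply: einj.
  have inT (x : A) : x \in [set: A] by rewrite inE.
  by have /(congr1 val) := 'inj_g (inT _) (inT _) gst.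
rewrite -(card_in_imset finj); apply: leq_trans (max_card _) _.
by rewrite card_ord.
Qed.

(** * Approximations extracted from the gamma functionals *)

Section gamma.
Variables (R : realType) (alpha b : R) (U : Type) (T : set U).
Variables (dist : U -> U -> \bar R) (J : finType) (e : J -> U).

Lemma gamma_ge0 : (forall s t, 0 <= dist s t)%E -> (0 <= gamma alpha T dist)%E.
Proof.
move=> d0; apply: le_ereal_inf_tmp => _ [Tn [TnT _ _] <-].
have [T0 [t0 t0T]] := TnT 0%N.
apply: (@le_trans _ _ (\sum_(0 <= n <oo)
    (2 `^ (n%:R / alpha))%:E * point_dist dist t0 (Tn n))%E).
  apply: nneseries_ge0 => n _ _; rewrite mule_ge0 ?lee_fin ?powR_ge0//.
  by apply: le_ereal_inf_tmp => _ [s _ <-]; exact: d0.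
by apply: ereal_sup_ubound; exists t0 => //; exact: T0.
Qed.

(** Half of [eta] pays for a nearly optimal admissible sequence, the other half for points that are
    only nearly nearest. *)
Lemma gamma_approximation (eta : R) : 0 < b ->
  (forall n, 2 `^ (n%:R / alpha) = b ^+ n) ->
  (forall s t, 0 <= dist s t)%E -> injective e -> (forall j, T (e j)) ->
  (forall t, T t -> exists j, e j = t) ->
  (gamma alpha T dist < +oo)%E -> 0 < eta ->
  exists a r, approximation (fun s t => fine (dist (e s) (e t))) b
    (fine (gamma alpha T dist) + eta) a r.
Proof.
move=> b0 bE d0 einj eT Te goo eta0.
have gfin : gamma alpha T dist \is a fin_num.
  by rewrite ge0_fin_numE// gamma_ge0.
set g := fine _.
have : (gamma alpha T dist < (g + eta / 2)%:E)%E.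
  by rewrite -(fineK gfin) lte_fin -/g; lra.
move=> /ereal_inf_lt[_ [Tn [TnT Tn0 Tnc] <-]] supT.
have pd0 n t : (0 <= point_dist dist t (Tn n))%E.
  by apply: le_ereal_inf_tmp => _ [s _ <-]; exact: d0.
have ser t : (\sum_(0 <= n <oo)
    (b ^+ n)%:E * point_dist dist (e t) (Tn n) <= (g + eta / 2)%:E)%E.
  apply: le_trans (ltW supT); apply: ereal_sup_ubound.
  exists (e t) => //; apply: eq_eseriesr => n _; by rewrite bE.
have term0 n t : (0 <= (b ^+ n)%:E * point_dist dist (e t) (Tn n))%E.
  by rewrite mule_ge0// lee_fin exprn_ge0// ltW.
have par t N : (\sum_(0 <= n < N)
    (b ^+ n)%:E * point_dist dist (e t) (Tn n) <= (g + eta / 2)%:E)%E.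
  apply: le_trans (ser t); apply: nneseries_lim_ge => n _ _; exact: term0.
(* The weights are positive, so one infinite distance would make a partial sum infinite. *)
have pdfin n t : point_dist dist (e t) (Tn n) \is a fin_num.
  rewrite ge0_fin_numE// ltNge leye_eq; apply/negP => /eqP E.
  have := par t n.+1; rewrite big_nat_recr//= E gt0_muley ?lte_fin ?exprn_gt0//.
  rewrite addey//; last first.
    by rewrite gt_eqF// (lt_le_trans (ltNyr 0))// sume_ge0.
(* Weighted by [b ^+ n], the slacks sum to at most [eta / 2]. *)
pose slack n := eta / 2 * 2^-1 ^+ n.+1 / b ^+ n.
have slack0 n : 0 < slack n.
  by rewrite divr_gt0 ?exprn_gt0// mulr_gt0 ?exprn_gt0 ?invr_gt0// divr_gt0.
pose r n t := fine (point_dist dist (e t) (Tn n)) + slack n.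
have near_pt (x : nat * J) : exists j, Tn x.1 (e j) /\
    (dist (e x.2) (e j) < (r x.1 x.2)%:E)%E.
  case: x => n t /=.
  have : (point_dist dist (e t) (Tn n) < (r n t)%:E)%E.
    by rewrite -(fineK (pdfin n t)) lte_fin /r ltrDl.
  move=> /ereal_inf_lt[_ [s sT <-] dr].
  have [j ej] := Te s ((TnT n).1 s sT).
  by exists j; rewrite ej.
have [a aP] := choice near_pt.
exists (fun n t => a (n, t)), r; split.
- move=> n t; have [_ /= dr] := aP (n, t).
  rewrite -lee_fin fineK ?(ltW dr)// ge0_fin_numE//.
  exact: lt_trans dr (ltry _).
- by move=> n t; rewrite addr_ge0 ?(ltW (slack0 n))// fine_ge0.
- move=> N t; have := par t N.
  rewrite big_mkord.
  under eq_bigr do rewrite -(fineK (pdfin _ t)) -EFinM.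
  rewrite sumEFin lee_fin => H.
  have -> : \sum_(n < N) b ^+ n * r n t =
      \sum_(n < N) b ^+ n * fine (point_dist dist (e t) (Tn n)) +
      eta / 2 * \sum_(n < N) 2^-1 ^+ n.+1.
    rewrite mulr_sumr -big_split/=; apply: eq_bigr => n _.
    by rewrite /r /slack; field; rewrite expf_neq0// gt_eqF.
  have := ler_wpM2l (ltW (divr_gt0 eta0 (ltr0Sn R 1))) (sum_halves R N).
  by move: H; rewrite -/g; lra.
- move=> n; apply: (@card_imset_admissible _ (Tn n) _ e) => //.
  + by rewrite expn_gt0.
  + by move=> t; have [] := aP (n, t).
  (* At level 0 admissibility gives exactly one point, below the required [2 ^ (2 ^ 0) = 2]. *)
  + case: n => [|n]; last exact: Tnc.
    move: Tn0; rewrite card_eq_le => /andP[T01 _].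
    apply: card_le_trans T01 _; apply: subset_card_le => x /=.
    by case: x.
Qed.

End gamma.

(** * The moments of the supremum along chains *)

Section moments.
Variable R : realType.

Lemma powR_le_expR (y p : R) : 1 <= y -> 0 <= p -> y `^ p <= expR (p * (y - 1)).
Proof.
move=> y1 p0; have y0 : 0 < y by lra.
rewrite /powR gt_eqF// ler_expR ler_wpM2l//.
by have := expR_ge1Dx (ln y); rewrite lnK ?posrE//; lra.
Qed.

Lemma exp2n_le_expR (k : nat) : (2 ^ k)%:R <= expR k%:R :> R.
Proof.
rewrite natrX -[k%:R]mulr1 expRM_natl.
apply: lerXn2r; rewrite ?nnegrE ?expR_ge0//.
by have := expR_ge1Dx (1 : R); lra.
Qed.

Lemma expR_opp_le (x : R) : 0 < x -> expR (- x) <= x^-1.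
Proof.
move=> x0; rewrite expRN lef_pV2 ?posrE ?expR_gt0//.
by have := expR_ge1Dx x; lra.
Qed.

Variable J : finType.

(** Each step is split at [t]. The first halves cost [b * 8 * G <= 16 * G], the second halves, after
    an index shift, [8 * G]; the quasi-metric factor 2 gives 48. *)
Lemma sum_chain_steps (dist : J -> J -> R) (b G : R) (pi : nat -> J -> J)
    (N : nat) (t : J) : 0 < b -> b <= 2 -> 0 <= G -> quasi_metric dist ->
  (forall s u, 0 <= dist s u) ->
  (forall N t, \sum_(n < N) b ^+ n * dist (pi n t) t <= 8 * G) ->
  \sum_(n < N) b ^+ n.+1 * dist (pi n t) (pi n.+1 t) <= 48 * G.
Proof.
move=> b0 b2 G0 qd d0 H.
apply: (@le_trans _ _ (2 * (b * (\sum_(n < N) b ^+ n * dist (pi n t) t)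
    + \sum_(n < N) b ^+ n.+1 * dist (pi n.+1 t) t))).
  rewrite mulr_sumr -big_split/= mulr_sumr; apply: ler_sum => n _.
  rewrite mulrA -exprS -mulrDr mulrCA; apply: ler_wpM2l; last exact: qd.
  by rewrite exprn_ge0// ltW.
have H1 : \sum_(n < N) b ^+ n.+1 * dist (pi n.+1 t) t <= 8 * G.
  apply: le_trans (H N.+1 t); rewrite big_ord_recl lerDr.
  by rewrite mulr_ge0// exprn_ge0// ltW.
have H2 : b * (\sum_(n < N) b ^+ n * dist (pi n t) t) <= 2 * (8 * G).
  apply: ler_pM (H N t) => //; first exact: ltW.
  by apply: sumr_ge0 => i _; rewrite mulr_ge0// exprn_ge0// ltW.
lra.
Qed.

End moments.

(** * Measurability and integrals of finite sums *)

Lemma measurable_sum_cond (R : realType) d (T : measurableType d)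
    (I : Type) (s : seq I) (Q : pred I) (f : I -> T -> R) :
  (forall i, measurable_fun setT (f i)) ->
  measurable_fun setT (fun x => \sum_(i <- s | Q i) f i x).
Proof.
by move=> mf; under eq_fun do rewrite -big_filter; exact: measurable_sum.
Qed.

Lemma ler_sum_from0 (R : numDomainType) (l N : nat) (f : nat -> R) :
  (l <= N)%N -> (forall n, 0 <= f n) ->
  \sum_(l <= n < N) f n <= \sum_(n < N) f n.
Proof.
move=> lN f0; rewrite -[leRHS](big_mkord predT f).
rewrite [leRHS](big_cat_nat (leq0n l) lN)/=.
by rewrite lerDr sumr_ge0.
Qed.

Lemma integral_sum_le (R : realType) d (T : measurableType d)
    (mu : {measure set T -> \bar R}) (I : Type) (s : seq I) (Q : pred I)
    (f : I -> T -> R) (M : I -> R) :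
  (forall i, Q i -> \int[mu]_x (f i x)%:E <= (M i)%:E)%E ->
  (forall i, measurable_fun setT (f i)) -> (forall i x, 0 <= f i x) ->
  (\int[mu]_x (\sum_(i <- s | Q i) f i x)%:E <=
   (\sum_(i <- s | Q i) M i)%:E)%E.
Proof.
move=> fM mf f0; rewrite -sumEFin.
under eq_integral do rewrite -sumEFin -big_filter.
rewrite ge0_integral_sum//; [|by move=> i; exact/measurable_EFinP
  |by move=> i x _; rewrite lee_fin].
by rewrite big_filter; apply: lee_sum.
Qed.

(** * The moment bound from exponential moments of increments and base points *)

Section chaining_moment.
Variables (R : realType) (d : measure_display) (Omega : measurableType d).
Variables (P : probability Omega R) (J : finType) (Z : J -> Omega -> R).
Variables (D1 D2 : J -> J -> R) (b2 c1 c2 B1 B2 G1 G2 p : R).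
Variables (a1 a2 : nat -> J -> J) (r1 r2 : nat -> J -> R).
Hypothesis mZ : forall j, measurable_fun setT (Z j).
Hypothesis D1_ge0 : forall s t, 0 <= D1 s t.
Hypothesis D2_ge0 : forall s t, 0 <= D2 s t.
Hypotheses (qD1 : quasi_metric D1) (qD2 : quasi_metric D2).
Hypotheses (b20 : 0 < b2) (b2E : b2 ^+ 2 = 2).
Hypotheses (c10 : 0 < c1) (c20 : 0 < c2) (B10 : 0 < B1) (B20 : 0 < B2).
Hypotheses (G10 : 0 < G1) (G20 : 0 < G2) (p1 : 1 <= p).
Hypothesis ap1 : approximation D1 2 G1 a1 r1.
Hypothesis ap2 : approximation D2 b2 G2 a2 r2.
Hypothesis Zinc : forall s t lambda, 0 <= lambda ->
  lambda * (c1 * D1 s t) < 1 ->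
  (\int[P]_w (expR (lambda * `|Z t w - Z s w|))%:E
    <= (2 * expR (lambda ^+ 2 * (c2 * D2 s t) ^+ 2))%:E)%E.
Hypothesis Zbase : forall t lambda, 0 <= lambda -> lambda * B1 <= 2^-1 ->
  (\int[P]_w (expR (lambda * `|Z t w|))%:E
    <= (2 * expR (lambda ^+ 2 * B2 ^+ 2))%:E)%E.

Let scale := Num.sqrt p * B2 + p * B1.

Let p0 : 0 < p. Proof. by move: p1; lra. Qed.

Let scale_gt0 : 0 < scale.
Proof. by rewrite addr_gt0// mulr_gt0// sqrtr_gt0. Qed.

(* Normalised size of an increment at level [n]: the first two summands make
   the exponential moment below finite and the last one keeps it positive. *)
Let delta (n : nat) s t :=
  c2 * (b2 ^+ n * D2 s t) + c1 * (2 ^+ n * D1 s t) + scale * 2^-1 ^+ n.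

(* The rate [10 * q] exceeds the entropy exponent [6 * q] of the union bound
   with enough room for the exponential moment of [V]. *)
Let excess (q : R) (V : Omega -> R) (del : R) (w : Omega) :=
  expR (10 * q * (`|V w| / (20 * del) - 1)).

Let measurable_excess q V del : measurable_fun setT V ->
  measurable_fun setT (excess q V del).
Proof.
move=> mV; apply: measurableT_comp => //; apply: measurable_funM => //.
apply: measurable_funB => //; apply: measurable_funM => //.
exact: measurableT_comp.
Qed.

Let excess_ge0 q V del w : 0 <= excess q V del w.
Proof. exact: expR_ge0. Qed.

(** For [y = |V w| / (20 * del)], either [y <= 1], or [y ^ p <= expR (p * (y - 1))], which is at
    most the excess because [p <= 10 * q]. In both cases [y ^ p <= 1 + x]. *)
Let powR_excess q V del w x : p <= q -> 0 < del -> 0 <= x ->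
  excess q V del w <= x -> `|V w| <= 20 * del * (1 + x) `^ p^-1.
Proof.
move=> pq d0 x0 ex; rewrite mulrC -ler_pdivrMr ?mulr_gt0//.
set y := `|V w| / _.
have y0 : 0 <= y by rewrite divr_ge0// ltW// mulr_gt0.
have yp : y `^ p <= 1 + x.
  have [y1|/ltW y1] := leP 1 y.
    apply: (le_trans (powR_le_expR y1 (ltW p0))).
    apply: (@le_trans _ _ (excess q V del w)); last by lra.
    rewrite ler_expR -/y; apply: ler_wpM2r; first by rewrite subr_ge0.
    by move: p0 pq; lra.
  apply: (@le_trans _ _ 1); last by lra.
  have -> : 1 = 1 `^ p :> R by rewrite powR1.
  by apply: ge0_ler_powR; rewrite ?nnegrE// ltW.
rewrite -[leLHS]powRr1// -[X in _ `^ X](mulfV (lt0r_neq0 p0)) powRrM.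
by apply: ge0_ler_powR; rewrite ?nnegrE ?powR_ge0 ?invr_ge0 ?(ltW p0)//; lra.
Qed.

(** The normalisation turns [10 * q / (20 * del)] into the rate [q / (2 * del)], and
    [- 10 * q + q / 4 <= - 9 * q]. *)
Let integral_excess q (V : Omega -> R) del v :
  0 < del -> 0 < q -> measurable_fun setT V ->
  (\int[P]_w (expR (q / (2 * del) * `|V w|))%:E
    <= (2 * expR v)%:E)%E -> v <= q / 4 ->
  (\int[P]_w (excess q V del w)%:E <= (2 * expR (- (9 * q)))%:E)%E.
Proof.
move=> d0 q0 mV H vq.
rewrite (eq_integral (fun w =>
    (expR (- (10 * q)) * expR (q / (2 * del) * `|V w|))%:E)); last first.
  move=> w _; rewrite /excess -expRD; congr (expR _)%:E.
  by field; rewrite gt_eqF.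
rewrite ge0_integralZl_EFin ?expR_ge0//; last first.
  apply: measurableT_comp => //; apply: measurable_funM => //.
  exact: measurableT_comp.
apply: (le_trans (lee_wpmul2l _ H)); first by rewrite lee_fin expR_ge0.
by rewrite -EFinM lee_fin mulrCA -expRD ler_pM2l// ler_expR; lra.
Qed.

Let delta_gt0 n s t : 0 < delta n s t.
Proof.
rewrite ltr_wpDl//; last by rewrite mulr_gt0// exprn_gt0// invr_gt0.
have hb : 0 <= b2 ^+ n by rewrite exprn_ge0// ltW.
by rewrite addr_ge0// !mulr_ge0 ?(ltW c20) ?(ltW c10)// exprn_ge0.
Qed.

(** At rate [2 ^ n / (2 * delta)], the [D1] summand of [delta] makes [Zinc] applicable, and the [D2]
    summand with [b2 ^+ 2 = 2] bounds the exponent by [2 ^ n / 4]. *)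
Let integral_excess_increment n s t :
  (\int[P]_w (excess (2 ^+ n) (fun w => (Z t w - Z s w)%R) (delta n s t) w)%:E
    <= (2 * expR (- (9 * 2 ^+ n)))%:E)%E.
Proof.
have W0 : 0 < 2 ^+ n :> R by rewrite exprn_gt0.
have d0 := delta_gt0 n s t.
have hb : 0 <= b2 ^+ n by rewrite exprn_ge0// ltW.
have x2 : 0 <= c2 * (b2 ^+ n * D2 s t) by rewrite !mulr_ge0// ltW.
have x1 : 0 <= c1 * (2 ^+ n * D1 s t) by rewrite !mulr_ge0// ltW.
have x3 : 0 < scale * 2^-1 ^+ n by rewrite mulr_gt0// exprn_gt0// invr_gt0.
apply: (@integral_excess _ _ _
    ((2 ^+ n / (2 * delta n s t)) ^+ 2 * (c2 * D2 s t) ^+ 2)) => //.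
- exact: measurable_funB.
- apply: Zinc; first by rewrite divr_ge0// ltW// mulr_gt0.
  have -> : 2 ^+ n / (2 * delta n s t) * (c1 * D1 s t) =
      c1 * (2 ^+ n * D1 s t) / (2 * delta n s t) by ring.
  rewrite ltr_pdivrMr ?mulr_gt0// mul1r.
  by apply: (@le_lt_trans _ _ (delta n s t)); move: d0; rewrite /delta; lra.
- have dd : c2 ^+ 2 * (2 ^+ n * D2 s t ^+ 2) <= delta n s t ^+ 2.
    rewrite (_ : _ * _ = (c2 * (b2 ^+ n * D2 s t)) ^+ 2); last first.
      by rewrite !exprMn -exprM mulnC exprM b2E.
    by apply: lerXn2r; rewrite ?nnegrE ?(ltW d0)// /delta; lra.
  rewrite ler_pdivlMr//.
  have -> : (2 ^+ n / (2 * delta n s t)) ^+ 2 * (c2 * D2 s t) ^+ 2 * 4 =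
      2 ^+ n * (c2 ^+ 2 * (2 ^+ n * D2 s t ^+ 2) / delta n s t ^+ 2).
    by field; rewrite gt_eqF.
  by rewrite ler_piMr ?(ltW W0)// ler_pdivrMr ?exprn_gt0// mul1r.
Qed.

(** At rate [p / (2 * scale)], [p * B1 <= scale] gives the admissibility condition of [Zbase] and
    [Num.sqrt p * B2 <= scale] bounds the exponent by [p / 4]. *)
Let integral_excess_base t :
  (\int[P]_w (excess p (Z t) scale w)%:E <= (2 * expR (- (9 * p)))%:E)%E.
Proof.
have s0 := scale_gt0; have pp := p0.
have sp : 0 < Num.sqrt p by rewrite sqrtr_gt0.
have x1 : 0 < p * B1 by rewrite mulr_gt0.
have x2 : 0 < Num.sqrt p * B2 by rewrite mulr_gt0.
apply: (@integral_excess _ _ _ ((p / (2 * scale)) ^+ 2 * B2 ^+ 2)) => //.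
- apply: Zbase; first by rewrite divr_ge0// ltW// mulr_gt0.
  have -> : p / (2 * scale) * B1 = 2^-1 * (p * B1 / scale).
    by field; rewrite gt_eqF.
  by rewrite ler_piMr// ler_pdivrMr// mul1r /scale; lra.
- have dd : p * B2 ^+ 2 <= scale ^+ 2.
    rewrite -{1}(sqr_sqrtr (ltW pp)) -exprMn.
    by apply: lerXn2r; rewrite ?nnegrE ?(ltW s0) ?(ltW x2)// /scale; lra.
  rewrite ler_pdivlMr//.
  have -> : (p / (2 * scale)) ^+ 2 * B2 ^+ 2 * 4 =
      p * (p * B2 ^+ 2 / scale ^+ 2) by field; rewrite gt_eqF.
  by rewrite ler_piMr ?(ltW pp)// ler_pdivrMr ?exprn_gt0// mul1r.
Qed.

(** The 20 is the normalisation of the excesses and 48 the cost of the chain steps. One [scale]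
    comes from the base point, the other from the last summands of the [delta]. The leading 3 is 1
    plus the bound 2 on the mean of [F]. *)
Lemma chaining_moment (Y : Omega -> R) : measurable_fun setT Y ->
  (forall w, 0 <= Y w) -> (forall w, exists j, Y w <= `|Z j w|) ->
  (\int[P]_w (Y w `^ p)%:E <=
   (3 * (20 * (48 * (c2 * G2 + c1 * G1) + 2 * scale)) `^ p)%:E)%E.
Proof.
move=> mY Y0 YZ.
have two0 : 0 < 2 :> R by [].
have [pi [L [card_pi pi_id sum1 sum2]]] :=
  chain_selection two0 b20 G10 G20 qD1 qD2 ap1 ap2.
have tp : (0 < Num.truncn p)%N by rewrite truncn_gt0.
pose l := trunc_log 2 (Num.truncn p).
have lp : 2 ^+ l <= p.
  have /andP[+ _] := truncn_itv (ltW p0); apply: le_trans.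
  by rewrite -natrX ler_nat trunc_logP.
have pl n : (l <= n)%N -> p <= 2 ^+ n.+1.
  move=> ln; have /andP[_ +] := truncn_itv (ltW p0) => /ltW pt.
  apply: (le_trans pt); rewrite -natrX ler_nat.
  apply: leq_trans (trunc_log_ltn (Num.truncn p) (isT : 1 < 2)%N) _.
  by rewrite leq_exp2l// ltnS.
(* [N >= L] makes the chain end at [j], and [N >= l] lets it start at level [l]. *)
pose N := maxn L l.
pose A n := [set pi n t | t : J]%SET.
pose F0 w := \sum_(j in A l) excess p (Z j) scale w.
pose F1 (n : nat) w := \sum_(u in finset.setX (A n) (A n.+1))
  excess (2 ^+ n.+1) (fun w => (Z u.2 w - Z u.1 w)%R) (delta n.+1 u.1 u.2) w.
pose F w := F0 w + \sum_(l <= n < N) F1 n w.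
have F00 w : 0 <= F0 w by apply: sumr_ge0 => j _; exact: excess_ge0.
have F10 n w : 0 <= F1 n w by apply: sumr_ge0 => j _; exact: excess_ge0.
have F_ge0 w : 0 <= F w by rewrite addr_ge0// sumr_ge0.
have mF0 : measurable_fun setT F0.
  by apply: measurable_sum_cond => j; exact: measurable_excess.
have mF1 n : measurable_fun setT (F1 n).
  apply: measurable_sum_cond => u; apply: measurable_excess.
  exact: measurable_funB.
have key w : Y w `^ p <=
    (20 * (48 * (c2 * G2 + c1 * G1) + 2 * scale)) `^ p * (1 + F w).
  have [j Yj] := YZ w.
  pose Q := (1 + F w) `^ p^-1.
  have Q0 : 0 <= Q by exact: powR_ge0.
  have base : `|Z (pi l j) w| <= 20 * scale * Q.
    apply: (powR_excess (lexx p) scale_gt0 (F_ge0 w)).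
    apply: (@le_trans _ _ (F0 w)); last by rewrite lerDl sumr_ge0.
    have piA : pi l j \in A l by exact: imset_f.
    by rewrite /F0 (bigD1 _ piA)/= lerDl sumr_ge0.
  (* The excess has rate parameter [2 ^+ n.+1], and [n >= l] ensures [p <= 2 ^+ n.+1]. *)
  have step n : (l <= n < N)%N -> `|Z (pi n.+1 j) w - Z (pi n j) w| <=
      20 * delta n.+1 (pi n j) (pi n.+1 j) * Q.
    move=> /andP[ln nN].
    apply: (powR_excess (V := fun w => Z (pi n.+1 j) w - Z (pi n j) w)
      (pl _ ln) (delta_gt0 _ _ _) (F_ge0 w)).
    apply: (@le_trans _ _ (F1 n w)); last first.
      apply: (@le_trans _ _ (\sum_(l <= n < N) F1 n w)); last by rewrite lerDr.
      rewrite (big_cat_nat ln)/= ?(ltnW nN)// [X in _ + X]big_ltn//.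
      by rewrite addrCA lerDl addr_ge0// sumr_ge0.
    have piA : (pi n j, pi n.+1 j) \in finset.setX (A n) (A n.+1).
      by rewrite inE/=; apply/andP; split; exact: imset_f.
    by rewrite /F1 (bigD1 _ piA)/= lerDl sumr_ge0.
  have sumd : \sum_(l <= n < N) delta n.+1 (pi n j) (pi n.+1 j) <=
      48 * (c2 * G2 + c1 * G1) + scale.
    have lN : (l <= N)%N by exact: leq_maxr.
    apply: (@le_trans _ _ (\sum_(n < N) delta n.+1 (pi n j) (pi n.+1 j))).
      apply: (ler_sum_from0
        (f := fun n => delta n.+1 (pi n j) (pi n.+1 j))) => //.
      by move=> n; exact: ltW (delta_gt0 _ _ _).
    rewrite !big_split/= -!mulr_sumr.
    have S2 := sum_chain_steps N j b20 _ (ltW G20) qD2 D2_ge0 sum2.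
    have S1 := sum_chain_steps N j two0 (lexx _) (ltW G10) qD1 D1_ge0 sum1.
    have S3 := ler_wpM2l (ltW scale_gt0) (sum_halves R N).
    have b2le : b2 <= 2.
      rewrite -(@ler_pXn2r _ 2)// ?nnegrE ?(ltW b20)// b2E.
      by rewrite -[leLHS]expr1 ler_eXn2l// ltr1n.
    have := ler_wpM2l (ltW c20) (S2 b2le); have := ler_wpM2l (ltW c10) S1.
    by move: S3; lra.
  have Zj : Y w <= 20 * (48 * (c2 * G2 + c1 * G1) + 2 * scale) * Q.
    apply: (le_trans Yj).
    have <- : pi N j = j by rewrite pi_id// leq_maxl.
    have -> : Z (pi N j) w = Z (pi l j) w +
        \sum_(l <= n < N) (Z (pi n.+1 j) w - Z (pi n j) w).
      by rewrite telescope_sumr ?leq_maxr// subrKC.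
    apply: (le_trans (ler_normD _ _)).
    apply: (le_trans (lerD base (ler_norm_sum _ _ _))).
    apply: (@le_trans _ _ (20 * scale * Q +
        \sum_(l <= n < N) 20 * delta n.+1 (pi n j) (pi n.+1 j) * Q)).
      by rewrite lerD2l; apply: ler_sum_nat => n lnN; exact: step.
    rewrite -mulr_suml -mulrDl; apply: ler_wpM2r => //.
    by rewrite -mulr_sumr -mulrDr ler_pM2l//; lra.
  have T0 : 0 <= 20 * (48 * (c2 * G2 + c1 * G1) + 2 * scale).
    have := scale_gt0; have := mulr_gt0 c20 G20; have := mulr_gt0 c10 G10; lra.
  apply: (@le_trans _ _
      ((20 * (48 * (c2 * G2 + c1 * G1) + 2 * scale) * Q) `^ p)).
    by apply: ge0_ler_powR; rewrite ?nnegrE ?(ltW p0)// mulr_ge0.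
  rewrite powRM// -powRrM mulVf ?gt_eqF// powRr1//.
  by rewrite addr_ge0.
have intF0 : (\int[P]_w (F0 w)%:E <= 1%:E)%E.
  apply: (le_trans (integral_sum_le (index_enum J) (Q := mem (A l))
    (f := fun j => excess p (Z j) scale)
    (fun j _ => integral_excess_base j) _ _)).
  - by move=> j; exact: measurable_excess.
  - by move=> j w; exact: excess_ge0.
  rewrite lee_fin sumr_const -[leLHS]mulr_natl.
  (* At most [2 ^ (4 * 2 ^ l) <= expR (4 * p)] base points occur, which leaves
     [2 * expR (- (5 * p)) <= 1]. *)
  apply: (@le_trans _ _ (expR (4 * p) * (2 * expR (- (9 * p))))).
    apply: ler_wpM2r; first by rewrite mulr_ge0// expR_ge0.
    apply: (@le_trans _ _ (2 ^ (4 * 2 ^ l))%:R).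
      by rewrite ler_nat; exact: card_pi l.
    apply: (le_trans (exp2n_le_expR _ _)).
    by rewrite ler_expR natrM ler_pM2l// natrX.
  rewrite mulrCA -expRD (_ : _ + _ = - (5 * p)); last by ring.
  have p50 : 0 < 5 * p by rewrite mulr_gt0.
  have := expR_opp_le p50; have : (5 * p)^-1 <= 2^-1.
    by rewrite lef_pV2 ?posrE//; move: p1; lra.
  by move: (expR _) => x; lra.
have intF1 n : (l <= n)%N -> (\int[P]_w (F1 n w)%:E <= (2^-1 ^+ n.+1)%:E)%E.
  move=> ln.
  apply: (le_trans (integral_sum_le (index_enum (J * J)%type)
    (Q := mem (finset.setX (A n) (A n.+1)))
    (f := fun u => excess (2 ^+ n.+1) (fun w => (Z u.2 w - Z u.1 w)%R)
       (delta n.+1 u.1 u.2))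
    (fun u _ => integral_excess_increment n.+1 u.1 u.2) _ _)).
  - by move=> u; apply: measurable_excess; exact: measurable_funB.
  - by move=> u w; exact: excess_ge0.
  rewrite lee_fin sumr_const -[leLHS]mulr_natl.
  have W0 : 0 < 2 ^+ n.+1 :> R by rewrite exprn_gt0.
  (* There are at most [2 ^ (4 * 2 ^ n + 4 * 2 ^ n.+1) = 2 ^ (6 * 2 ^ n.+1)] pairs, which leaves
     [2 * expR (- (3 * 2 ^+ n.+1))], below [2^-1 ^+ n.+1]. *)
  apply: (@le_trans _ _
      (expR (6 * 2 ^+ n.+1) * (2 * expR (- (9 * 2 ^+ n.+1))))).
    apply: ler_wpM2r; first by rewrite mulr_ge0// expR_ge0.
    apply: (@le_trans _ _ (2 ^ (6 * 2 ^ n.+1))%:R).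
      rewrite ler_nat cardsX (_ : 6 * _ = 4 * 2 ^ n + 4 * 2 ^ n.+1)%N.
        by rewrite expnD; apply: leq_mul; exact: card_pi.
      by rewrite expnS !mulnA -mulnDl.
    apply: (le_trans (exp2n_le_expR _ _)).
    by rewrite ler_expR natrM natrX.
  rewrite mulrCA -expRD (_ : _ + _ = - (3 * 2 ^+ n.+1)); last by ring.
  have W30 : 0 < 3 * 2 ^+ n.+1 :> R by rewrite mulr_gt0.
  have := expR_opp_le W30; rewrite invfM exprVn.
  have : 0 < (2 ^+ n.+1)^-1 :> R by rewrite invr_gt0.
  by move: (expR _) (_^-1) => x y; lra.
have intF : (\int[P]_w (F w)%:E <= 2%:E)%E.
  rewrite (eq_integral (fun w =>
    (1 * F0 w + 1 * \sum_(l <= n < N) F1 n w)%:E)); last first.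
    by move=> w _; rewrite !mul1r.
  rewrite ge0_integral_lin//.
  - rewrite !mul1e (_ : 2%:E = 1%:E + 1%:E :> \bar R)%E; last by rewrite -EFinD.
    apply: leeD; first exact: intF0.
    under eq_integral do rewrite big_nat.
    apply: (le_trans (integral_sum_le (index_iota l N)
      (Q := fun n => (l <= n < N)%N) (f := F1) (M := fun n => 2^-1 ^+ n.+1)
      _ mF1 F10)).
      by move=> n /andP[ln _]; exact: intF1.
    rewrite lee_fin -big_nat; apply: le_trans (sum_halves R N).
    apply: (ler_sum_from0 (f := fun n => 2^-1 ^+ n.+1)) => //.
    exact: leq_maxr.
  - by apply: measurable_sum.
  - by move=> w; apply: sumr_ge0.
apply: (@le_trans _ _ (\int[P]_w
    ((20 * (48 * (c2 * G2 + c1 * G1) + 2 * scale)) `^ p * (1 + F w))%:E)%E).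
  apply: ge0_le_integral => //.
  - by move=> w _; rewrite lee_fin powR_ge0.
  - apply/measurable_EFinP; exact: (measurableT_comp (measurable_powR p) mY).
  - apply/measurable_EFinP; apply: measurable_funM => //.
    apply: measurable_funD => //; apply: measurable_funD => //.
    exact: measurable_sum.
  - by move=> w _; rewrite lee_fin.
set T := 20 * _.
rewrite (eq_integral (fun w => (T `^ p * 1 + T `^ p * F w)%:E)); last first.
  by move=> w _; rewrite mulrDr.
have mF : measurable_fun setT F.
  by apply: measurable_funD => //; exact: measurable_sum.
rewrite ge0_integral_lin ?powR_ge0//.
have -> : (\int[P]_w (1%:E : \bar R) = 1%:E)%E.
  by rewrite (integral_cst P measurableT 1%:E) mul1e; exact: probability_setT.
rewrite (_ : 3 * T `^ p = T `^ p * 1 + T `^ p * 2); last by ring.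
rewrite EFinD !EFinM; apply: leeD => //.
by apply: lee_wpmul2l intF; rewrite lee_fin powR_ge0.
Qed.
End chaining_moment.

(** * The empirical process *)

Lemma sqrtr_quasi (R : rcfType) (x y z : R) : 0 <= x -> 0 <= y -> 0 <= z ->
  z <= 2 * x + 2 * y -> Num.sqrt z <= 2 * (Num.sqrt x + Num.sqrt y).
Proof.
move=> x0 y0 z0 zxy; have sx := sqrtr_ge0 x; have sy := sqrtr_ge0 y.
have sxy : 0 <= 2 * (Num.sqrt x + Num.sqrt y) by rewrite mulr_ge0// addr_ge0.
rewrite -(@ler_pXn2r _ 2)// ?nnegrE ?sqrtr_ge0// sqr_sqrtr//.
apply: (le_trans zxy); rewrite -{1}(sqr_sqrtr x0) -{1}(sqr_sqrtr y0).
by move: sx sy; move: (Num.sqrt _) (Num.sqrt _) => a b; nra.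
Qed.

Section empirical_process.
Variables (R : realType) (m : nat) (d : 'I_m -> measure_display).
Variables (Omega : forall i, measurableType (d i)).
Variables (P : forall i, probability (Omega i) R).
Variables (PP : probability (prod_space Omega) R).
Variables (S : Type) (X : forall i, S -> {RV (P i) >-> R}).
Hypothesis m0 : (0 < m)%N.

Let psi i (s t : m.-tuple S) := fine (increment_psi1 X i s t).

Lemma increment_psi1_triangle i s t a :
  (increment_psi1 X i s t <= increment_psi1 X i s a + increment_psi1 X i t a)%E.
Proof.
rewrite {3}/increment_psi1 (@psi1_norm_normE _ _ _ _ _
  (X i (tnth t i) \- X i (tnth a i))%R); last by move=> w; exact: distrC.
rewrite /increment_psi1 (_ : (_ \- _)%R = ((X i (tnth a i) \- X i (tnth s i)) \+
  (X i (tnth t i) \- X i (tnth a i)))%R); last by apply/funext => w /=; ring.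
by apply: psi1_normD; exact: measurable_funB.
Qed.

Lemma d1_ge0 s t : (0 <= d1 X s t)%E.
Proof.
apply: (@le_trans _ _ (increment_psi1 X (Ordinal m0) s t)).
  exact: psi1_norm_ge0.
exact: le_bigmax.
Qed.

Lemma d2_ge0 s t : (0 <= d2 X s t)%E.
Proof. exact: sqrte_ge0. Qed.

Variable T : set (m.-tuple S).
Hypothesis subexpT : forall t i, T t -> subexponential (P i) (X i (tnth t i)).

Lemma psi_ge0 i s t : 0 <= psi i s t.
Proof. by rewrite fine_ge0// psi1_norm_ge0. Qed.

Lemma increment_psi1E i s t : T s -> T t ->
  increment_psi1 X i s t = (psi i s t)%:E.
Proof.
by move=> Ts Tt; rewrite fineK// increment_psi1_fin//; exact: subexpT.
Qed.

Lemma psi_triangle i s t a : T s -> T t -> T a ->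
  psi i s t <= psi i s a + psi i t a.
Proof.
move=> Ts Tt Ta; have := increment_psi1_triangle i s t a.
by rewrite !increment_psi1E// -EFinD lee_fin.
Qed.

Lemma d1_fin s t : T s -> T t -> d1 X s t \is a fin_num.
Proof.
move=> Ts Tt; rewrite ge0_fin_numE ?d1_ge0//.
apply: bigmax_lt => [|i _]; first by [].
by rewrite increment_psi1E// ltry.
Qed.

Lemma psi_le_d1 i s t : T s -> T t -> psi i s t <= fine (d1 X s t).
Proof.
move=> Ts Tt; rewrite -lee_fin -increment_psi1E// fineK ?d1_fin//.
exact: le_bigmax.
Qed.

Lemma fine_d2 s t : T s -> T t ->
  fine (d2 X s t) = Num.sqrt (m%:R^-1 * \sum_(i < m) psi i s t ^+ 2).
Proof.
move=> Ts Tt; rewrite /d2.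
under eq_bigr do rewrite increment_psi1E// -EFin_expe.
by rewrite sumEFin -EFinM.
Qed.

Lemma d1_quasi s t a : T s -> T t -> T a ->
  fine (d1 X s t) <= 2 * (fine (d1 X s a) + fine (d1 X t a)).
Proof.
move=> Ts Tt Ta.
have g1 : 0 <= fine (d1 X s a) by rewrite fine_ge0// d1_ge0.
have g2 : 0 <= fine (d1 X t a) by rewrite fine_ge0// d1_ge0.
apply: (@le_trans _ _ (fine (d1 X s a) + fine (d1 X t a))); last by lra.
rewrite -lee_fin fineK ?d1_fin//.
apply: bigmax_le => [|i _]; first exact: leNye.
rewrite increment_psi1E// lee_fin; apply: (le_trans (psi_triangle i Ts Tt Ta)).
by apply: lerD; exact: psi_le_d1.
Qed.

Lemma d2_quasi s t a : T s -> T t -> T a ->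
  fine (d2 X s t) <= 2 * (fine (d2 X s a) + fine (d2 X t a)).
Proof.
move=> Ts Tt Ta; rewrite !fine_d2//.
have q0 u v : 0 <= m%:R^-1 * \sum_(i < m) psi i u v ^+ 2.
  by rewrite mulr_ge0 ?invr_ge0//; apply: sumr_ge0 => i _; exact: sqr_ge0.
apply: sqrtr_quasi => //.
have H i : psi i s t ^+ 2 <= 2 * psi i s a ^+ 2 + 2 * psi i t a ^+ 2.
  apply: (@le_trans _ _ ((psi i s a + psi i t a) ^+ 2)).
    apply: lerXn2r; rewrite ?nnegrE ?addr_ge0 ?psi_ge0//.
    exact: psi_triangle.
  have := sqr_ge0 (psi i s a - psi i t a).
  by move: (psi i s a) (psi i t a) => y z; nra.
have := ler_sum (index_enum 'I_m) (P := predT) (fun i _ => H i).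
rewrite big_split/= -!mulr_sumr => Hs.
have mV : 0 <= m%:R^-1 :> R by rewrite invr_ge0.
apply: (le_trans (ler_wpM2l mV Hs)); rewrite mulrDr.
by apply: lerD; rewrite mulrCA.
Qed.

Section enumeration.
Variables (k : nat) (e : 'I_k -> m.-tuple S).
Hypotheses (eT : forall j, T (e j)) (Te : forall t, T t -> exists j, e j = t).
Hypothesis T0 : T !=set0.

(** The default 0 of the maximum is harmless because the values are nonnegative and [T] is
    nonempty. *)
Lemma sup_empE w :
  sup_emp X T w = \big[Num.max/0]_(j < k) `|emp X (e j) w|.
Proof.
have ub : ubound [set `|emp X t w| | t in T]
    (\big[Num.max/0]_(j < k) `|emp X (e j) w|).
  by move=> _ [t Tt <-]; have [j <-] := Te Tt; exact: le_bigmax.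
have nub : has_ubound [set `|emp X t w| | t in T].
  by exists (\big[Num.max/0]_(j < k) `|emp X (e j) w|).
apply/eqP; rewrite eq_le; apply/andP; split.
  apply: ge_sup => //; have [t Tt] := T0; by exists `|emp X t w|, t.
have le_sup j : `|emp X (e j) w| <= sup_emp X T w.
  by apply: ub_le_sup => //; exists (e j).
apply: bigmax_le => //.
have [t Tt] := T0; have [j _] := Te Tt.
by apply: le_trans (le_sup j).
Qed.

Lemma sup_emp_ge0 w : 0 <= sup_emp X T w.
Proof. by rewrite sup_empE; exact: bigmax_ge_id. Qed.

Lemma sup_emp_attained w : exists j, sup_emp X T w <= `|emp X (e j) w|.
Proof.
have [t Tt] := T0; have [j0 _] := Te Tt.
rewrite sup_empE.
have nn j : predT j -> 0 <= `|emp X (e j) w| by move=> _; exact: normr_ge0.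
have [j _ ->] := eq_bigmax j0 predT (fun j => `|emp X (e j) w|) isT nn.
by exists j.
Qed.

Lemma measurable_sup_emp_enum : measurable_fun setT (sup_emp X T).
Proof.
rewrite (_ : sup_emp X T = fun w => \big[Num.max/0]_(j < k) `|emp X (e j) w|).
  elim: (index_enum _) => [|j s IH].
    by rewrite (_ : (fun _ => _) = cst 0)//; apply/funext => w; rewrite big_nil.
  rewrite (_ : (fun _ => _) = (fun w => `|emp X (e j) w|) \max
      (fun w => \big[Num.max/0]_(j <- s) `|emp X (e j) w|)).
    apply: measurable_maxr => //.
    by apply: measurableT_comp => //; exact: measurable_emp.
  by apply/funext => w; rewrite big_cons.
by apply/funext => w; exact: sup_empE.
Qed.

End enumeration.

Variables (sigma K : R).
Hypothesis hPP : is_product_measure P PP.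
Hypotheses (finT : finite_set T) (T0 : T !=set0).
Hypotheses (sigma0 : 0 < sigma) (K0 : 0 < K).
Hypothesis bernstein : forall q : nat, (2 <= q)%N -> forall t, T t ->
  (m%:R^-1%:E *
      \sum_(i < m) 'E_(P i)[fun w => (`|centered X (tnth t i) w| ^+ q)%R]
    <= (q`!%:R / 2 * sigma ^+ 2 * K ^+ (q - 2))%:E)%E.

Let c1 : R := m%:R^-1.
Let c2 : R := (Num.sqrt m%:R)^-1.
Let g1 := fine (gamma 1 T (d1 X)).
Let g2 := fine (gamma 2 T (d2 X)).

Lemma measurable_sup_emp : measurable_fun setT (sup_emp X T).
Proof.
have [k [e [_ eT Te]]] := finite_set_enumeration finT.
exact: measurable_sup_emp_enum eT Te T0.
Qed.

(** The errors [eta1], [eta2] add one [scale] to the chaining part, so the constants are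
    [20 * 48 = 960] for the gamma terms and [20 * (48 + 2) = 1000] for [scale]. *)
Lemma sup_emp_moment (p : R) : 1 <= p ->
  (gamma 1 T (d1 X) < +oo)%E -> (gamma 2 T (d2 X) < +oo)%E ->
  (\int[PP]_w (sup_emp X T w `^ p)%:E <=
   (3 * (1000 * (c2 * g2 + c1 * g1 +
      (Num.sqrt p * (sigma / Num.sqrt m%:R) + p * (K / m%:R)))) `^ p)%:E)%E.
Proof.
move=> p1 g1oo g2oo; set scale := _ + p * _.
have [k [e [einj eT Te]]] := finite_set_enumeration finT.
have mR : 0 < m%:R :> R by rewrite ltr0n.
have p0 : 0 < p by lra.
have sm : 0 < Num.sqrt m%:R :> R by rewrite sqrtr_gt0.
have c10 : 0 < c1 by rewrite invr_gt0.
have c20 : 0 < c2 by rewrite invr_gt0.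
have B10 : 0 < K / m%:R by rewrite divr_gt0.
have B20 : 0 < sigma / Num.sqrt m%:R by rewrite divr_gt0.
have scale0 : 0 < scale by rewrite addr_gt0// mulr_gt0// sqrtr_gt0.
have c2sq : c2 ^+ 2 = m%:R^-1 by rewrite exprVn sqr_sqrtr// ltW.
have g10 : 0 <= g1 by rewrite fine_ge0// gamma_ge0//; exact: d1_ge0.
have g20 : 0 <= g2 by rewrite fine_ge0// gamma_ge0//; exact: d2_ge0.
(* Chosen so that [c1 * eta1] and [c2 * eta2] are both [scale / 2]; being positive, they also make
   the radii [g1 + eta1] and [g2 + eta2] positive. *)
pose eta1 := scale / 2 / c1; pose eta2 := scale / 2 / c2.
have eta10 : 0 < eta1 by rewrite !divr_gt0.
have eta20 : 0 < eta2 by rewrite !divr_gt0.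
pose b2 : R := 2 `^ 2^-1.
have b20 : 0 < b2 by rewrite powR_gt0.
have b2E : b2 ^+ 2 = 2 by rewrite /b2 powR12_sqrt// sqr_sqrtr.
have [a1 [r1 ap1]] : exists a r, approximation
    (fun s t => fine (d1 X (e s) (e t))) 2 (g1 + eta1) a r.
  apply: (gamma_approximation (T := T) (alpha := 1)) => //.
  - by move=> n; rewrite divr1 powR_mulrn.
  - exact: d1_ge0.
have [a2 [r2 ap2]] : exists a r, approximation
    (fun s t => fine (d2 X (e s) (e t))) b2 (g2 + eta2) a r.
  apply: (gamma_approximation (T := T) (alpha := 2)) => //.
  - by move=> n; rewrite mulrC powRrM powR_mulrn// powR_ge0.
  - exact: d2_ge0.
have D1_ge0 s t : 0 <= fine (d1 X (e s) (e t)) by rewrite fine_ge0// d1_ge0.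
have D2_ge0 s t : 0 <= fine (d2 X (e s) (e t)) by rewrite fine_ge0// d2_ge0.
have qD1 : quasi_metric (fun s t => fine (d1 X (e s) (e t))).
  by move=> s t a; exact: d1_quasi.
have qD2 : quasi_metric (fun s t => fine (d2 X (e s) (e t))).
  by move=> s t a; exact: d2_quasi.
have Zinc s t lambda : 0 <= lambda ->
    lambda * (c1 * fine (d1 X (e s) (e t))) < 1 ->
    (\int[PP]_w (expR (lambda * `|emp X (e t) w - emp X (e s) w|))%:E
     <= (2 * expR (lambda ^+ 2 * (c2 * fine (d2 X (e s) (e t))) ^+ 2))%:E)%E.
  move=> l0 l1.
  (* One factor [1 / m] comes from [c2 ^+ 2], the other from the mean inside [d2]. *)
  have -> : lambda ^+ 2 * (c2 * fine (d2 X (e s) (e t))) ^+ 2 =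
      (lambda / m%:R) ^+ 2 * \sum_(i < m) psi i (e s) (e t) ^+ 2.
    rewrite fine_d2// exprMn c2sq sqr_sqrtr.
      by rewrite exprMn; ring.
    by rewrite mulr_ge0// ?invr_ge0// sumr_ge0// => i _; exact: sqr_ge0.
  apply: integral_expR_emp_increment => //.
  - by move=> i; exact: subexpT.
  - by move=> i; exact: subexpT.
  - move=> i; apply: le_lt_trans l1; rewrite mulrA.
    by apply: ler_wpM2l (psi_le_d1 i (eT s) (eT t)); rewrite divr_ge0.
have Zbase t lambda : 0 <= lambda -> lambda * (K / m%:R) <= 2^-1 ->
    (\int[PP]_w (expR (lambda * `|emp X (e t) w|))%:E
     <= (2 * expR (lambda ^+ 2 * (sigma / Num.sqrt m%:R) ^+ 2))%:E)%E.
  move=> l0 l1; rewrite exprMn exprVn sqr_sqrtr ?(ltW mR)// mulrA.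
  apply: (integral_expR_emp hPP m0 (K := K)) => //.
  - by move=> i; exact: subexpT.
  - by move=> q q2; exact: bernstein.
  - by rewrite mulrAC -mulrA.
have mZ j : measurable_fun setT (emp X (e j)) by exact: measurable_emp.
apply: (le_trans (chaining_moment mZ D1_ge0 D2_ge0 qD1 qD2 b20 b2E c10 c20 B10
  B20 (ltr_wpDl g10 eta10) (ltr_wpDl g20 eta20) p1 ap1 ap2 Zinc Zbase
  measurable_sup_emp (sup_emp_ge0 eT Te T0) (sup_emp_attained eT Te T0))).
rewrite -/scale lee_fin ler_pM2l//.
have h1 : c1 * (g1 + eta1) = c1 * g1 + scale / 2.
  by rewrite /eta1; field; rewrite gt_eqF.
have h2 : c2 * (g2 + eta2) = c2 * g2 + scale / 2.
  by rewrite /eta2; field; rewrite gt_eqF.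
rewrite h1 h2.
have x1 : 0 <= c1 * g1 := mulr_ge0 (ltW c10) g10.
have x2 : 0 <= c2 * g2 := mulr_ge0 (ltW c20) g20.
move: (c1 * g1) (c2 * g2) x1 x2 => x y x0 y0.
apply: (ge0_ler_powR (ltW p0)).
- by rewrite nnegrE; lra.
- by rewrite nnegrE; lra.
- by lra.
Qed.

End empirical_process.

(** * From a moment bound to the norm and to the tail *)

Section moment_to_tail.
Variables (R : realType) (d : measure_display) (T : measurableType d).
Variables (P : probability T R) (Y : T -> R).
Hypotheses (mY : measurable_fun setT Y) (Y0 : forall w, 0 <= Y w).

(** The root of the factor 3 is at most 3 because [p >= 1]. *)
Lemma poweR_moment_le (p q : R) : 1 <= p -> 0 <= q ->
  (\int[P]_w (Y w `^ p)%:E <= (3 * q `^ p)%:E ->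
   (\int[P]_w (Y w `^ p)%:E) `^ p^-1 <= (3 * q)%:E)%E.
Proof.
move=> p1 q0 H; have p0 : 0 < p by lra.
have I0 : (0 <= \int[P]_w (Y w `^ p)%:E)%E.
  by apply: integral_ge0 => w _; rewrite lee_fin powR_ge0.
have pV0 : 0 <= p^-1 by rewrite invr_ge0 ltW.
apply: (@le_trans _ _ ((3 * q `^ p)%:E `^ p^-1)%E).
  apply: gt0_ler_poweR => //; rewrite in_itv/= ?I0 ?leey// lee_fin.
  by rewrite mulr_ge0// powR_ge0.
rewrite poweR_EFin lee_fin powRM ?powR_ge0// -powRrM mulfV ?gt_eqF// powRr1//.
apply: ler_wpM2r => //; rewrite -[leRHS]powRr1//.
by apply: ler_powR; rewrite ?invf_le1//; lra.
Qed.

(** Markov's inequality at [3 * expR 1 * q] gives [3 / (3 ^ u * expR u)], and [3 <= 3 ^ u]. *)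
Lemma tail_of_moment (u q : R) : 1 <= u -> 0 < q ->
  (\int[P]_w (Y w `^ u)%:E <= (3 * q `^ u)%:E)%E ->
  (P [set w | (3 * expR 1 * q <= Y w)%R] <= (expR (- u))%:E)%E.
Proof.
move=> u1 q0 H; set t := 3 * expR 1 * q; set A := [set w | _].
have u0 : 0 < u by lra.
have e0 : 0 < expR 1 :> R by exact: expR_gt0.
have t0 : 0 < t by rewrite !mulr_gt0.
have mA : measurable A.
  rewrite (_ : A = setT `&` Y @^-1` `[t, +oo[); first exact: mY.
  by rewrite setTI; apply/seteqP; split => w; rewrite /A/= in_itv/= andbT.
have tA : ((t `^ u)%:E * P A <= (3 * q `^ u)%:E)%E.
  apply: le_trans H.
  rewrite -[A]setIT -integral_indic// -ge0_integralZl_EFin ?powR_ge0//.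
  apply: ge0_le_integral => //.
  - by move=> w _; rewrite lee_fin mulr_ge0// powR_ge0.
  - by apply/measurable_EFinP; apply: measurable_funM.
  - apply/measurable_EFinP; exact: (measurableT_comp (measurable_powR u) mY).
  - move=> w _; rewrite lee_fin indicE.
    case: (boolP (w \in A)) => [|_]; last by rewrite mulr0 powR_ge0.
    rewrite inE /A/= mulr1 => tY.
    by apply: ge0_ler_powR => //; rewrite ?nnegrE ?(ltW t0) ?(ltW u0).
have PAf : P A \is a fin_num by exact: fin_num_measure.
move: tA; rewrite -(fineK PAf) -EFinM !lee_fin.
have : 0 <= fine (P A) by rewrite fine_ge0.
move: (fine (P A)) => a a0.
have qu0 : 0 < q `^ u by rewrite powR_gt0.
have -> : t `^ u = 3 `^ u * expR u * q `^ u.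
  rewrite /t powRM ?mulr_ge0 ?(ltW q0)// powRM//; congr (_ * _ * _).
  by rewrite /powR gt_eqF// expRK mulr1.
rewrite mulrAC ler_pM2r// => tA.
rewrite expRN -[leRHS]mul1r ler_pdivlMr ?expR_gt0// mulrC.
have h3 : 3 <= 3 `^ u :> R.
  by rewrite -[leLHS]powRr1//; apply: ler_powR => //; lra.
have x0 : 0 <= expR u * a by rewrite mulr_ge0// expR_ge0.
rewrite -(@ler_pM2l _ 3)// mulr1; apply: le_trans tA.
by rewrite -mulrA; exact: ler_wpM2r.
Qed.

End moment_to_tail.

(** * Combination of the moment and tail bounds with universal constants *)

Local Open Scope ereal_scope.

(* Infinite [x1] or [x2] make the moment bound trivial and the tail event
   empty. *)
Lemma moment_tail_bounds (R : realType) (d : measure_display)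
    (T : measurableType d) (P : probability T R) (Y : T -> R)
    (x1 x2 : \bar R) (c1 c2 s k b : R) :
  measurable_fun setT Y -> (forall w, (0 <= Y w)%R) ->
  0 <= x1 -> 0 <= x2 ->
  (0 < c1)%R -> (0 < c2)%R -> (0 < s)%R -> (0 < k)%R -> (0 < b)%R ->
  (x1 < +oo -> x2 < +oo -> forall p, (1 <= p)%R ->
    \int[P]_w (Y w `^ p)%:E <= (3 * (b * (c2 * fine x2 + c1 * fine x1 +
      (Num.sqrt p * s + p * k))) `^ p)%:E) ->
  (forall p, (1 <= p)%R ->
    'E_P[fun w => (Y w `^ p)%R] `^ p^-1 <= (3 * b)%:E *
      (c2%:E * x2 + c1%:E * x1 + (Num.sqrt p * s)%:E + (p * k)%:E)) /\
  (forall u, (1 <= u)%R ->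
    P [set w | (3 * expR 1 * b)%:E * (c2%:E * x2 + c1%:E * x1) +
        (3 * expR 1 * b * (s * Num.sqrt u + k * u))%:E <= (Y w)%:E]
    <= (expR (- u))%:E).
Proof.
move=> mY Y0 x10 x20 c10 c20 s0 k0 b0 moment.
have C0 : (0 < 3 * expR 1 * b)%R by rewrite !mulr_gt0// expR_gt0.
have C'0 : (0 < 3 * b)%R by rewrite mulr_gt0.
have [goo|[g1 [g2 [E1 E2]]]] : c2%:E * x2 + c1%:E * x1 = +oo \/
    exists g1 g2, x1 = g1%:E /\ x2 = g2%:E.
  case: x1 x10 {moment} => [g1||] //; case: x2 x20 => [g2||] // _ _.
  - by right; exists g1, g2.
  - by left; rewrite gt0_muley ?lte_fin// addye.
  - by left; rewrite gt0_muley ?lte_fin// addey.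
  - by left; rewrite !gt0_muley ?lte_fin.
- rewrite goo; split => [p p1|u u1].
    by rewrite !addye// gt0_muley ?leey ?lte_fin.
  rewrite gt0_muley ?lte_fin// addye// (_ : [set w | _] = set0).
    by rewrite measure0 lee_fin expR_ge0.
  by apply/seteqP; split => // w /=; rewrite leye_eq.
move: x10 x20 moment; rewrite {}E1 {}E2 !lee_fin /= => g10 g20.
move=> /(_ (ltry _) (ltry _)) moment.
have bound p : (1 <= p)%R ->
    (0 < b * (c2 * g2 + c1 * g1 + (Num.sqrt p * s + p * k)))%R.
  move=> p1; have p0 : (0 < p)%R by lra.
  rewrite mulr_gt0// ltr_wpDl//.
    by rewrite addr_ge0// mulr_ge0// ltW.
  by rewrite addr_gt0// mulr_gt0// sqrtr_gt0.
split=> [p p1|u u1].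
  rewrite unlock.
  apply: (le_trans (poweR_moment_le p1 (ltW (bound p p1)) (moment p p1))).
  by rewrite lee_fin -mulrA !addrA.
apply: le_trans (tail_of_moment mY Y0 u1 (bound u u1) (moment u u1)).
rewrite le_eqVlt; apply/orP; left; apply/eqP; congr (P _).
apply: eq_set => w; rewrite lee_fin.
by congr (is_true (_ <= _)%R); ring.
Qed.

Theorem corollary5p2 (R : realType) :
  exists c C C' : R, [/\ (0 < c)%R, (0 < C)%R & (0 < C')%R] /\
  forall (m : nat) (d : 'I_m -> measure_display)
    (Omega : forall i, measurableType (d i))
    (P : forall i, probability (Omega i) R)
    (PP : probability (prod_space Omega) R)
    (S : Type) (T : set (m.-tuple S))
    (X : forall i, S -> {RV (P i) >-> R}) (sigma K : R),
    (0 < m)%N ->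
    is_product_measure P PP ->
    finite_set T -> T !=set0 ->
    (forall t i, T t -> subexponential (P i) (X i (tnth t i))) ->
    (0 < sigma)%R -> (0 < K)%R ->
    (forall q : nat, (2 <= q)%N ->
      ereal_sup [set (m%:R^-1)%:E *
          \sum_(i < m) 'E_(P i)[fun w => (`|centered X (tnth t i) w| ^+ q)%R]
        | t in T]
      <= (q`!%:R / 2 * sigma ^+ 2 * K ^+ (q - 2))%:E) ->
    (forall p : R, (1 <= p)%R ->
      'E_PP[fun w => (sup_emp X T w `^ p)%R] `^ p^-1 <=
      C'%:E * ((Num.sqrt m%:R)^-1%:E * gamma 2 T (d2 X)
               + (m%:R^-1)%:E * gamma 1 T (d1 X)
               + (Num.sqrt p * (sigma / Num.sqrt m%:R))%:E
               + (p * (K / m%:R))%:E)) /\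
    (forall u : R, (1 <= u)%R ->
      PP [set w |
        C%:E * ((Num.sqrt m%:R)^-1%:E * gamma 2 T (d2 X)
                + (m%:R^-1)%:E * gamma 1 T (d1 X))
        + (c * (sigma / Num.sqrt m%:R * Num.sqrt u + K / m%:R * u))%:E
        <= (sup_emp X T w)%:E]
      <= (expR (- u))%:E).
Proof.
(* 1000 is the chaining constant, 3 comes from the leading factor of the moment bound, and [expR 1]
   from Markov's inequality. *)
exists (3 * expR 1 * 1000)%R, (3 * expR 1 * 1000)%R, (3 * 1000)%R.
have k0 : (0 < 1000 :> R)%R by rewrite ltr0n.
have C0 : (0 < 3 * expR 1 * 1000 :> R)%R.
  exact: mulr_gt0 (mulr_gt0 (ltr0Sn R 2) (expR_gt0 1)) k0.
have C'0 : (0 < 3 * 1000 :> R)%R := mulr_gt0 (ltr0Sn R 2) k0.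
split; first by split.
move=> m d Omega P PP S T X sigma K m0 hPP finT T0 subexpT sigma0 K0 mom.
have mom' (q : nat) : (2 <= q)%N -> forall t, T t -> (m%:R^-1)%:E *
    \sum_(i < m) 'E_(P i)[fun w => (`|centered X (tnth t i) w| ^+ q)%R]
    <= (q`!%:R / 2 * sigma ^+ 2 * K ^+ (q - 2))%:E.
  move=> q2 t Tt; apply: le_trans (mom q q2).
  by apply: ereal_sup_ubound; exists t.
have Y0 w : (0 <= sup_emp X T w)%R.
  have [k [e [_ eT Te]]] := finite_set_enumeration finT.
  exact: sup_emp_ge0 eT Te T0 w.
have mR : (0 < m%:R :> R)%R by rewrite ltr0n.
have sm : (0 < Num.sqrt m%:R :> R)%R by rewrite sqrtr_gt0.
apply: moment_tail_bounds.
- exact: (@measurable_sup_emp R m d Omega P S X T finT T0).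
- exact: Y0.
- by apply: gamma_ge0; exact: d1_ge0.
- by apply: gamma_ge0; exact: d2_ge0.
- by rewrite invr_gt0.
- by rewrite invr_gt0.
- exact: divr_gt0.
- exact: divr_gt0.
- exact: k0.
- move=> g1oo g2oo p p1.
  exact: (sup_emp_moment m0 subexpT hPP finT T0 sigma0 K0 mom' p1 g1oo g2oo).
Qed.
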